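(* Let $n\ge 6$ and consider the set $\mathscr{U}_{n,3}$ of $n$-vertex unicyclic graphs with matching number $3$. (i) If $n=6$ or $n=7$, then $U_{n,3}^*$ is the unique graph with the second minimal eccentric distance sum $\xi^d$ among the graphs in $\mathscr{U}_{n,3}$. (ii) If $n=8$ or $n=9$, then $U_{n,3}$ is the unique graph with the second minimal eccentric distance sum $\xi^d$ among the graphs in $\mathscr{U}_{n,3}$. (iii) If $n\ge 10$, then $\xi^d(G)\ge 6n^2-5n-53$ for every $G\in\mathscr{U}_{n,3}\setminus\{U_{n,3}\}$, with equality if and only if $G\cong U_{n,3}'$.
   Context: All graphs are finite, simple and connected, and considered up to isomorphism. For a graph $G$ and $v\in V_G$, $d(u,v)$ is the usual graph distance, $\varepsilon_G(v)=\max_{u\in V_G} d(u,v)$ is the eccentricity, and $D_G(v)=\sum_{u\in V_G} d(u,v)$. The eccentric distance sum is $\xi^d(G)=\sum_{v\in V_G}\varepsilon_G(v)D_G(v)$. A unicyclic graph is a connected graph with $|V_G|=|E_G|$. The matching number is the maximum number of pairwise independent edges. $\mathscr{U}_{n,m}$ is the set of unicyclic graphs with $n$ vertices and matching number $m$. $U_{n,3}$ is the $n$-vertex graph obtained from a triangle $u_1u_2u_3u_1$ by attaching to $u_1$ exactly $n-5$ pendant vertices and one pendant path of length $2$ (identifying one of its end vertices with $u_1$). $U_{n,3}'$ is the $n$-vertex graph obtained from a cycle $C_5$ by attaching $n-5$ pendant vertices to one of its vertices. $U_{n,3}^*$ is the $n$-vertex graph obtained from a triangle $u_1u_2u_3u_1$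 by attaching $n-5$ pendant vertices to $u_1$, one pendant vertex to $u_2$ and one pendant vertex to $u_3$. *)

(* Defs.v *)
From mathcomp Require Import all_boot.

Set Implicit Arguments.
Unset Strict Implicit.
Unset Printing Implicit Defensive.

Record sgraph := SGraph {
  vertex :> finType;
  adj : rel vertex;
  adj_sym : symmetric adj;
  adj_irrefl : irreflexive adj }.

Definition isomorphic (G H : sgraph) : Prop :=
  exists2 f : G -> H, bijective f & {mono f : x y / @adj G x y >-> @adj H x y}.

Section GraphInvariants.
Variable G : sgraph.
Implicit Types x y u v : G.

Definition edges : {set {set G}} := [set [set x; y] | x in G, y in G & adj x y].

Definition connected : bool := [forall x : G, forall y : G, connect (@adj G) x y].

Definition unicyclic : bool := connected && (#|G| == #|edges|).

Definition has_walk (k : nat) x y : bool :=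
  [exists p : k.-tuple G, path (@adj G) x p && (last x p == y)].

(* The least length of a walk from x to y, or #|G| when y is not reachable
   from x; reachable vertices are at distance less than #|G|. *)
Definition dist x y : nat := find (fun k => has_walk k x y) (iota 0 #|G|).

Definition eccentricity v : nat := \max_(u : G) dist u v.

Definition dist_sum v : nat := \sum_(u : G) dist u v.

Definition ecc_dist_sum : nat := \sum_(v : G) eccentricity v * dist_sum v.

Definition matching (M : {set {set G}}) : bool := (M \subset edges) && trivIset M.

Definition matching_number : nat := \max_(M : {set {set G}} | matching M) #|M|.

Lemma has_walkP k x y :
  reflect (exists p, [/\ path (@adj G) x p, last x p = y & size p = k])
          (has_walk k x y).
Proof.
apply: (iffP existsP) => [[p /andP[xp /eqP xy]]|[p [xp xy sp]]].
  by exists p; rewrite size_tuple.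
have sp' : size p == k by apply/eqP.
by exists (Tuple sp') => /=; rewrite xp xy eqxx.
Qed.

Lemma dist_walk x y : connect (@adj G) x y -> has_walk (dist x y) x y.
Proof.
case/connectP => p xp ->.
case: (shortenP xp) => q xq uq _.
have lq : size q < #|G| by have := card_uniqP uq => /= <-; apply: max_card.
have hq : has (fun k => has_walk k x (last x q)) (iota 0 #|G|).
  apply/hasP; exists (size q); first by rewrite mem_iota.
  by apply/has_walkP; exists q.
have := nth_find 0 hq; rewrite nth_iota // -[X in _ < X](size_iota 0).
by rewrite -has_find.
Qed.

Lemma dist_min x y k : has_walk k x y -> dist x y <= k.
Proof.
move=> wk; rewrite leqNgt; apply/negP => lk.
have lkG : k < #|G|.
  by apply: leq_trans lk _; rewrite -[X in _ <= X](size_iota 0) find_size.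
by have := before_find 0 lk; rewrite nth_iota // wk.
Qed.

End GraphInvariants.

Definition unicyclic_class (n m : nat) (G : sgraph) : Prop :=
  [/\ unicyclic G, #|G| = n & matching_number G = m].

(* f G is the second smallest value taken by f on the class P. *)
Definition second_minimal (P : sgraph -> Prop) (f : sgraph -> nat) (G : sgraph) : Prop :=
  P G /\ exists G0 : sgraph,
    [/\ P G0, forall H, P H -> f G0 <= f H, f G0 < f G
      & forall H, P H -> f G0 < f H -> f G <= f H].

Definition unique_second_minimal
    (P : sgraph -> Prop) (f : sgraph -> nat) (G : sgraph) : Prop :=
  second_minimal P f G /\ forall H, second_minimal P f H -> isomorphic H G.

Section EdgeList.
Variables (n : nat) (s : seq (nat * nat)).

Definition list_adj : rel 'I_n := fun i j =>
  (i != j) && (((val i, val j) \in s) || ((val j, val i) \in s)).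

Lemma list_adj_sym : symmetric list_adj.
Proof. by move=> i j; rewrite /list_adj eq_sym orbC. Qed.

Lemma list_adj_irrefl : irreflexive list_adj.
Proof. by move=> i; rewrite /list_adj eqxx. Qed.

(* Pairs of s with an entry outside {0, ..., n-1} contribute no edge. *)
Definition list_graph : sgraph := SGraph list_adj_sym list_adj_irrefl.

End EdgeList.

(* In the three graphs below, 0 is the vertex carrying the n - 5 pendant
   vertices 5, ..., n - 1; they have the intended n vertices for n >= 5. *)
Definition pendants (n : nat) : seq (nat * nat) := [seq (0, k) | k <- iota 5 (n - 5)].

Definition triangle : seq (nat * nat) := [:: (0, 1); (1, 2); (2, 0)].

Definition U3 (n : nat) : sgraph :=
  list_graph n (triangle ++ [:: (0, 3); (3, 4)] ++ pendants n).

Definition U3' (n : nat) : sgraph :=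
  list_graph n ([:: (0, 1); (1, 2); (2, 3); (3, 4); (4, 0)] ++ pendants n).

Definition U3star (n : nat) : sgraph :=
  list_graph n (triangle ++ [:: (1, 3); (2, 4)] ++ pendants n).

(* Main.v *)
Require Import Defs.
From mathcomp Require Import all_boot zify.

(** Deleting a leaf v which some maximum matching avoids keeps the matching
    number, and such a leaf exists as soon as n > 3m = 9, by counting edges. If s
    is the neighbour of v, the eccentric distance sum drops by at least
    18 n - 6 deg s - 29: all vertices are at distance at least 3 from v and have
    eccentricity 3 or more, except s and its neighbours, and at most two of these
    neighbours have eccentricity 2. The last point holds because in a graph with
    one cycle at most two edges at s start a path to a given vertex. This
    increment propagates the bound 6n^2 - 5n - 44 by induction, for all graphs
    but the three extremal families; these are reproduced when s is their vertex
    0, and otherwise s has degree at most 4, so the increment is much larger. The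
    induction starts with n = 6, ..., 9, where the graphs are enumerated as a
    breadth-first spanning tree plus one edge, and each is checked by
    computation. *)

Set Implicit Arguments.
Unset Strict Implicit.
Unset Printing Implicit Defensive.

(** * Distances and isomorphisms *)

Section Distance.
Variable G : sgraph.
Implicit Types x y z u v : G.

Lemma has_walk_rcons k x y z :
  has_walk k x y -> adj y z -> has_walk k.+1 x z.
Proof.
move=> /has_walkP[p [xp <- <-]] yz; apply/has_walkP; exists (rcons p z).
by rewrite rcons_path xp yz last_rcons size_rcons.
Qed.

Lemma has_walk_cons k x y z :
  adj x y -> has_walk k y z -> has_walk k.+1 x z.
Proof.
by move=> xy /has_walkP[p [yp <- <-]]; apply/has_walkP; exists (y :: p); rewrite /= xy.
Qed.

Lemma distxx x : dist x x = 0.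
Proof.
by apply/eqP; rewrite -leqn0; apply: dist_min; apply/has_walkP; exists [::].
Qed.

Lemma dist_eq0 x y : connect (@adj G) x y -> dist x y = 0 -> x = y.
Proof. by move=> /dist_walk/[swap]-> /has_walkP[[|z p] [_ /= <- //]]. Qed.

(** Along a shortest walk [d] grows by at most one per edge. The distance comparisons for
    isomorphisms, leaf deletion and tables all come from this. *)
Lemma Lipschitz_le_dist (d : G -> nat) x y :
  connect (@adj G) x y -> d x = 0 ->
  (forall u v, adj u v -> d v <= (d u).+1) -> d y <= dist x y.
Proof.
move=> /dist_walk/has_walkP[p [xp <- <-]] dx0 dL.
rewrite -[size p]add0n -dx0 {dx0}.
elim: p x xp => [|z p IHp] x /=; first by rewrite addn0.
by case/andP=> xz /IHp/leq_trans; apply; have := dL _ _ xz; lia.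
Qed.

Lemma connectedP : reflect (forall x y, connect (@adj G) x y) (connected G).
Proof.
apply: (iffP forallP) => [h x y|h x]; first by have /forallP := h x; apply.
exact/forallP.
Qed.

Section Connected.
Hypothesis cG : connected G.

Let conn x y : connect (@adj G) x y.
Proof. exact: connectedP. Qed.

Lemma dist_adjr x y z : adj y z -> dist x z <= (dist x y).+1.
Proof. by move=> yz; apply/dist_min/(has_walk_rcons _ yz)/dist_walk. Qed.

Lemma dist_adjl x y z : adj x y -> dist x z <= (dist y z).+1.
Proof. by move=> xy; apply/dist_min/(has_walk_cons xy)/dist_walk. Qed.

Lemma dist_sym x y : dist x y = dist y x.
Proof.
wlog suff: x y / dist y x <= dist x y.
  by move=> h; apply/eqP; rewrite eqn_leq !h.
apply: (@Lipschitz_le_dist (fun z => dist z x)); rewrite ?distxx // => u v uv.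
by apply: dist_adjl; rewrite adj_sym.
Qed.

Lemma dist_gt0 x y : (0 < dist x y) = (x != y).
Proof.
case: eqP => [->|ne]; first by rewrite distxx.
by case: (posnP (dist x y)) => // /(dist_eq0 (conn x y)).
Qed.

Lemma dist_gt1 x y : x != y -> ~~ adj x y -> 1 < dist x y.
Proof.
rewrite -dist_gt0 => d0 nxy; rewrite ltn_neqAle d0 andbT eq_sym; apply/eqP => d1.
have := dist_walk (conn x y); rewrite d1 => /has_walkP[[|z [|? ?]] [//=]].
by rewrite andbT => xz zy; rewrite zy (negbTE nxy) in xz.
Qed.

Lemma dist_adj x y : adj x y -> dist x y = 1.
Proof.
move=> xy; apply/eqP; rewrite eqn_leq dist_gt0; apply/andP; split.
  by rewrite -(distxx x); apply: dist_adjr.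
by apply: contraTneq xy => ->; rewrite adj_irrefl.
Qed.

Lemma exists_parent r x : x != r -> exists2 y, adj x y & dist y r < dist x r.
Proof.
rewrite -dist_gt0 => d0; have := dist_walk (conn x r).
case/has_walkP => [[|y p] []]; first by move=> _ _ /= d1; rewrite -d1 in d0.
move=> /= /andP[xy yp] yr sp; exists y => //; rewrite -sp ltnS.
by apply: dist_min; apply/has_walkP; exists p.
Qed.

End Connected.

Lemma leq_ecc u v : dist u v <= eccentricity v.
Proof. exact: (leq_bigmax (F := fun u => dist u v)). Qed.

Lemma ecc_leq v k : (forall u, dist u v <= k) -> eccentricity v <= k.
Proof. by move=> h; apply/bigmax_leqP. Qed.

End Distance.

Section Isomorphism.

Lemma isomorphic_sym (G H : sgraph) : isomorphic G H -> isomorphic H G.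
Proof.
move=> [f [g fK gK] fM]; exists g; first by exists f.
by move=> x y; rewrite -fM !gK.
Qed.

Lemma isomorphic_trans (G H K : sgraph) :
  isomorphic G H -> isomorphic H K -> isomorphic G K.
Proof.
move=> [f fb fM] [g gb gM]; exists (g \o f); first exact: bij_comp.
by move=> x y /=; rewrite gM fM.
Qed.

Variables (G H : sgraph) (f : G -> H).
Hypotheses (fB : bijective f) (fM : {mono f : x y / adj x y >-> adj x y}).

Lemma connect_iso x y : connect (@adj G) x y -> connect (@adj H) (f x) (f y).
Proof.
case/connectP=> p xp ->; apply/connectP; exists (map f p); last by rewrite last_map.
by apply: homo_path xp => u v; rewrite fM.
Qed.

Lemma connected_iso : connected G -> connected H.
Proof.
move/connectedP => cG; apply/connectedP => x y; have [g _ gK] := fB.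
by rewrite -(gK x) -(gK y); apply: connect_iso.
Qed.

Lemma dist_iso_leq x y : connected G -> dist (f x) (f y) <= dist x y.
Proof.
move=> cG; apply: (@Lipschitz_le_dist G (fun z => dist (f x) (f z))).
- exact: connectedP.
- by rewrite distxx.
by move=> u v uv; apply: dist_adjr; [apply: connected_iso|rewrite fM].
Qed.

End Isomorphism.

Lemma dist_iso (G H : sgraph) (f : G -> H) x y : connected G ->
  bijective f -> {mono f : x y / adj x y >-> adj x y} -> dist (f x) (f y) = dist x y.
Proof.
move=> cG fB fM; have cH := connected_iso fB fM cG.
apply/eqP; rewrite eqn_leq dist_iso_leq //=.
have [g fK gK] := fB; rewrite -{1}(fK x) -{1}(fK y); apply: dist_iso_leq => //.
  by exists f.
by move=> u v; rewrite -fM !gK.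
Qed.

Lemma ecc_dist_sum_iso (G H : sgraph) :
  connected G -> isomorphic G H -> ecc_dist_sum G = ecc_dist_sum H.
Proof.
move=> cG [f fB fM]; rewrite [RHS](reindex f) /=; last exact: onW_bij.
apply: eq_bigr => v _; rewrite /eccentricity /dist_sum; congr (_ * _).
  rewrite [RHS](reindex f) /=; last exact: onW_bij.
  by apply: eq_bigr => u _; rewrite dist_iso.
rewrite [RHS](reindex f) /=; last exact: onW_bij.
by apply: eq_bigr => u _; rewrite dist_iso.
Qed.

(** * Edges and matchings *)

Section Edges.
Variable G : sgraph.
Implicit Types x y z u v : G.

Definition deg x := #|[set y | adj x y]|.

Lemma adj_neq x y : adj x y -> x != y.
Proof. by apply: contraTneq => ->; rewrite adj_irrefl. Qed.

Lemma edgesP (e : {set G}) :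
  reflect (exists x y, adj x y /\ e = [set x; y]) (e \in edges G).
Proof.
apply: (iffP imset2P) => [[x y _]|[x [y [xy ->]]]].
  by rewrite inE => xy ->; exists x, y; case/andP: xy.
by exists x y; rewrite // inE xy.
Qed.

Lemma mem_edges x y : adj x y -> [set x; y] \in edges G.
Proof. by move=> xy; apply/edgesP; exists x, y. Qed.

Lemma eq_set2 (T : finType) (x y z t : T) :
  [set x; y] = [set z; t] -> (x = z /\ y = t) \/ (x = t /\ y = z).
Proof.
move=> /setP e; move: (e x) (e y) (e z) (e t); rewrite !inE !eqxx ?orbT /=.
move=> /esym/orP[]/eqP ? /esym/orP[]/eqP ?; subst; auto.
  by rewrite eqxx orbT orbb => _ /eqP->; auto.
by rewrite eqxx !orbb => /eqP->; auto.
Qed.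

Lemma deg_edges x : deg x = #|[set e in edges G | x \in e]|.
Proof.
rewrite /deg -(card_in_imset (f := fun y => [set x; y])).
  apply: eq_card => e; rewrite !inE; apply/imsetP/andP => [[y]|].
    by rewrite inE => xy ->; rewrite mem_edges // set21.
  case=> /edgesP[y [z [yz ->]]]; rewrite !inE => /orP[]/eqP->.
    by exists z; rewrite ?inE.
  by exists y; rewrite ?inE 1?adj_sym // setUC.
move=> y z; rewrite !inE => xy xz /eq_set2[[]//|[xz' yx]].
by rewrite yx adj_irrefl in xy.
Qed.

(** Handshake lemma, by counting the incidences between vertices and edges in both orders. *)
Lemma sum_deg : \sum_x deg x = 2 * #|edges G|.
Proof.
under eq_bigr do rewrite deg_edges -sum1_card.
rewrite (exchange_big_dep (mem (edges G))) /=; last by move=> x e _; rewrite inE => /andP[].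
rewrite mulnC -sum_nat_const; apply: eq_bigr => e eE.
rewrite (eq_bigl (mem e)) => [|x]; last by rewrite inE eE.
case/edgesP: eE => x [y [xy ->]].
by rewrite sum1_card cards2 adj_neq.
Qed.

(* A rank decreasing along parent links makes these links n - 1 distinct
   edges, which leaves exactly one edge of the graph. *)
Lemma unicyclic_extra_edge (r : G) (p : G -> G) (rk : G -> nat) :
    unicyclic G ->
    (forall x, x != r -> adj x (p x) /\ rk (p x) < rk x) ->
  exists a b, [/\ adj a b, (a != r -> b != p a), (b != r -> a != p b) &
    forall x y, adj x y ->
      [\/ x != r /\ y = p x, y != r /\ x = p y, x = a /\ y = b | x = b /\ y = a]].
Proof.
move=> /andP[_ /eqP cE] pP.
pose T := [set [set x; p x] | x in [set~ r]].
have TE : T \subset edges G.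
  apply/subsetP => e /imsetP[x]; rewrite !inE => xr ->.
  by apply: mem_edges; case: (pP x xr).
have cT : #|T| = #|G|.-1.
  rewrite card_in_imset ?cardsC1 // => x y; rewrite !inE => xr yr.
  (* Two vertices with the same link would be parents of each other, and the rank would decrease
     both ways. *)
  have [_ lx] := pP x xr; have [_ ly] := pP y yr.
  case/eq_set2=> [[//]|[ex ey]]; rewrite ey in lx; rewrite -ex in ly; lia.
have : #|edges G :\: T| = 1.
  rewrite cardsD (setIidPr TE) cT -cE.
  have : 0 < #|G| by apply/card_gt0P; exists r.
  by case: #|G| => // k _; rewrite subSnn.
move/eqP/cards1P => [e eD].
have: e \in edges G :\: T by rewrite eD set11.
rewrite inE => /andP[eT /edgesP[a [b [ab ee]]]]; subst e.
exists a, b; split=> //.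
- move=> ar; apply: contraNneq eT => ->; apply/imsetP; exists a => //; by rewrite !inE.
- move=> br; apply: contraNneq eT => ->; apply/imsetP; exists b; rewrite ?inE //.
  by rewrite setUC.
move=> x y xy; case: (boolP ([set x; y] \in T)) => [/imsetP[z]|xyT].
  by rewrite !inE => zr /eq_set2[[-> ->]|[-> ->]]; [apply: Or41|apply: Or42].
have: [set x; y] \in edges G :\: T by rewrite inE xyT mem_edges.
by rewrite eD inE => /eqP/eq_set2[[-> ->]|[-> ->]]; [apply: Or43|apply: Or44].
Qed.

End Edges.

Section Matching.

(** Matchings are handled as lists of oriented edges; independence then means that this list of
    endpoints has no repetition. *)
Definition pair_vertices (T : Type) (l : seq (T * T)) := unzip1 l ++ unzip2 l.

Lemma pair_vertices_cons (T : eqType) (x y : T) l :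
  perm_eq (pair_vertices ((x, y) :: l)) [:: x, y & pair_vertices l].
Proof. by rewrite /pair_vertices /= perm_cons -cat1s perm_catCA. Qed.

Lemma uniq_pair_vertices_cons (T : eqType) (x y : T) l :
  uniq (pair_vertices ((x, y) :: l)) =
  [&& x != y, x \notin pair_vertices l, y \notin pair_vertices l
    & uniq (pair_vertices l)].
Proof. by rewrite (perm_uniq (pair_vertices_cons _ _ _)) /= inE negb_or -!andbA. Qed.

Lemma mem_pair_vertices_cons (T : eqType) (x y z : T) l :
  (z \in pair_vertices ((x, y) :: l)) = [|| z == x, z == y | z \in pair_vertices l].
Proof. by rewrite (perm_mem (pair_vertices_cons _ _ _)) !inE. Qed.

Lemma size_pair_vertices (T : Type) (l : seq (T * T)) :
  size (pair_vertices l) = 2 * size l.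
Proof. by rewrite size_cat !size_map; lia. Qed.

Variable G : sgraph.

Definition disjoint_edges (l : seq (G * G)) :=
  all (fun p => adj p.1 p.2) l && uniq (pair_vertices l).

Lemma edges_neq0 : set0 \notin edges G.
Proof.
by apply/negP => /edgesP[x [y [_ e]]]; have := set21 x y; rewrite -e inE.
Qed.

(** The clause on endpoints strengthens the induction: it makes the next edge disjoint from all
    members of [M]. *)
Lemma disjoint_edges_matching l : disjoint_edges l ->
  exists2 M : {set {set G}}, matching M &
    #|M| = size l /\ (forall e : {set G}, e \in M -> {subset e <= pair_vertices l}).
Proof.
elim: l => [|[x y] l IHl].
  move=> _; exists set0; last by rewrite cards0; split=> // e; rewrite inE.
  by rewrite /matching sub0set /trivIset /cover !big_set0 cards0.
rewrite /disjoint_edges uniq_pair_vertices_cons /=.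
case/andP=> /andP[xy al] /and4P[nxy nx ny ul].
have [|M /andP[ME tM] [cM vM]] := IHl; first by rewrite /disjoint_edges al.
have [] := @trivIsetU1 _ [set x; y] M _ tM.
- move=> e /vM eM; rewrite disjoint_subset; apply/subsetP => z.
  by rewrite !inE => /orP[]/eqP->; [apply: contra nx|apply: contra ny] => /eM.
- by apply: contra edges_neq0; apply: (subsetP ME).
move=> tM' nM; exists ([set x; y] |: M).
  by rewrite /matching tM' subUset sub1set mem_edges // ME.
split=> [|e]; first by rewrite cardsU1 nM cM.
rewrite !inE => /orP[/eqP->|/vM eM] z.
  by rewrite mem_pair_vertices_cons !inE => /orP[]->; rewrite ?orbT.
by move/eM; rewrite mem_pair_vertices_cons => ->; rewrite !orbT.
Qed.

Lemma matching_disjoint_edges (M : {set {set G}}) : matching M ->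
  exists2 l, disjoint_edges l & size l = #|M| /\ {subset pair_vertices l <= cover M}.
Proof.
have [k] := ubnP #|M|; elim: k M => // k IHk M; rewrite ltnS => cM.
have [->|[e eM]] := set_0Vmem M.
  by exists [::]; rewrite ?cards0.
case/andP => ME tM; have /edgesP[x [y [xy ee]]] := subsetP ME _ eM.
have [||l /andP[al ul] [sl vl]] := IHk (M :\ e).
- by rewrite (cardsD1 e) eM in cM.
- by rewrite /matching trivIsetD // (subset_trans _ ME) // subsetDl.
have ne z : z \in e -> z \notin pair_vertices l.
  move=> ze; apply: contraL ze => /vl/bigcupP[f]; rewrite !inE => /andP[fe fM] zf.
  by have := trivIsetP tM _ _ fM eM fe => /disjointFr ->.
exists ((x, y) :: l).
  rewrite /disjoint_edges uniq_pair_vertices_cons /= xy al ul adj_neq //.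
  by rewrite !ne // ee !inE eqxx ?orbT.
split=> [|z]; first by rewrite /= sl (cardsD1 e M) eM.
rewrite mem_pair_vertices_cons orbA => /orP[zxy|/vl].
  by apply/bigcupP; exists e; rewrite // ee !inE.
by move/bigcupP => [f]; rewrite !inE => /andP[_ fM] zf; apply/bigcupP; exists f.
Qed.

Lemma disjoint_edges_take k l : disjoint_edges l -> disjoint_edges (take k l).
Proof.
case/andP=> al ul; apply/andP; split.
  by apply/allP => p /mem_take/(allP al).
apply: subseq_uniq ul; rewrite -{2}[l](cat_take_drop k).
by apply: cat_subseq; rewrite /unzip1 /unzip2 map_cat prefix_subseq.
Qed.

(** A prefix of a list of disjoint edges is again one, so every size up to the maximum is attained
    exactly. *)
Lemma matching_numberP k :
  reflect (exists2 l, disjoint_edges l & size l = k) (k <= matching_number G).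
Proof.
apply: (iffP idP) => [|[l /disjoint_edges_matching[M mM [<- _]] <-]]; last first.
  exact: leq_bigmax_cond.
have [M mM ->]: {M : {set {set G}} | matching M & matching_number G = #|M|}.
  apply: eq_bigmax_cond; apply/card_gt0P; exists set0.
  by rewrite /in_mem /= /matching sub0set /trivIset /cover !big_set0 cards0.
have [l dl [sl _]] := matching_disjoint_edges mM => kM.
by exists (take k l); [apply: disjoint_edges_take|rewrite size_takel // sl].
Qed.

End Matching.

Lemma matching_number_le (G H : sgraph) (f : G -> H) :
  injective f -> {homo f : x y / adj x y} -> matching_number G <= matching_number H.
Proof.
move=> fI fM; have /matching_numberP[l /andP[al ul] <-] := leqnn (matching_number G).
apply/matching_numberP; exists [seq (f p.1, f p.2) | p <- l]; last exact: size_map.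
apply/andP; split; first by rewrite all_map; apply: sub_all al => p /fM.
by rewrite /pair_vertices /unzip1 /unzip2 -!map_comp (map_comp f) [X in _ ++ X](map_comp f) -map_cat map_inj_uniq.
Qed.

Lemma matching_number_iso (G H : sgraph) :
  isomorphic G H -> matching_number G = matching_number H.
Proof.
move=> h; apply/eqP; rewrite eqn_leq; apply/andP; split.
  by case: h => f fB fM; apply: (matching_number_le (bij_inj fB)) => x y; rewrite fM.
case: (isomorphic_sym h) => f fB fM.
by apply: (matching_number_le (bij_inj fB)) => x y; rewrite fM.
Qed.

Lemma deg_iso (G H : sgraph) (f : G -> H) x :
  bijective f -> {mono f : x y / adj x y >-> adj x y} -> deg (f x) = deg x.
Proof.
move=> fB fM; rewrite /deg -(card_imset _ (bij_inj fB)); apply: eq_card => y.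
have [g fK gK] := fB; rewrite inE -{1}(gK y) fM.
by rewrite -{2}(gK y) mem_imset ?inE //; apply: bij_inj.
Qed.

(** * Deletion of a leaf *)

Section VertexDeletion.
Variables (G : sgraph) (v : G).

Definition del_adj : rel {x : G | x != v} := fun x y => adj (val x) (val y).

Lemma del_adj_sym : symmetric del_adj.
Proof. by move=> x y; apply: adj_sym. Qed.

Lemma del_adj_irrefl : irreflexive del_adj.
Proof. by move=> x; apply: adj_irrefl. Qed.

Definition del_vertex : sgraph := SGraph del_adj_sym del_adj_irrefl.

Definition undel (x : del_vertex) : G := val x.

Lemma undel_inj : injective undel. Proof. exact: val_inj. Qed.

Lemma undelP x : x != v -> exists x', undel x' = x.
Proof. by move=> xv; exists (exist _ x xv). Qed.

Lemma undel_neq x : undel x != v. Proof. exact: (valP x). Qed.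

Lemma undel_adj x y : adj (undel x) (undel y) = adj x y. Proof. by []. Qed.

Lemma sum_undel (F : G -> nat) : \sum_x F (undel x) = \sum_(x | x != v) F x.
Proof.
have [s0 _|noG] := pickP (xpredT : pred del_vertex).
  rewrite [RHS](reindex undel) /=; first by apply: eq_bigl => x; rewrite undel_neq.
  exists (insubd s0) => x; rewrite ?inE => xv; last by rewrite /undel insubdK.
  by apply: undel_inj; rewrite /undel insubdK ?undel_neq // inE undel_neq.
rewrite !big1 // => x; last by have := noG x.
by case/undelP => x' _; have := noG x'.
Qed.

Lemma card_del_vertex : #|del_vertex|.+1 = #|G|.
Proof.
rewrite card_sig (cardD1 v (mem G)) inE add1n; congr _.+1.
by apply: eq_card => x; rewrite !inE andbT.
Qed.

End VertexDeletion.

Section LeafDeletion.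
Variables (G : sgraph) (v s : G).
Hypothesis vs : forall x, adj v x = (x == s).
Local Notation H := (del_vertex v).

Let svP : s != v. Proof. by rewrite eq_sym adj_neq // vs. Qed.

Lemma deg_leaf : deg v = 1.
Proof. by rewrite /deg -(cards1 s); apply: eq_card => x; rewrite !inE vs. Qed.

Lemma deg_undel (x : H) : deg (undel x) = deg x + (undel x == s).
Proof.
rewrite /deg (cardsD1 v) inE adj_sym vs addnC; congr (_ + _).
rewrite -(card_imset _ (@undel_inj _ v)); apply: eq_card => y.
rewrite !inE; apply/andP/imsetP => [[yv xy]|[y' xy' ->]].
  by have [y' ey] := undelP yv; exists y'; rewrite // inE -undel_adj ey.
by rewrite inE in xy'; rewrite undel_neq undel_adj.
Qed.

Hypothesis cG : connected G.

Lemma del_leaf_connected : connected H.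
Proof.
have [s' es] := undelP svP.
(* This retraction folds [v] onto its neighbour: the default [s'] is taken exactly at [v]. It maps
   walks of [G] to walks of [H], up to stationary steps. *)
pose f (x : G) : H := odflt s' [pick x' | undel x' == x].
have fK x : f (undel x) = x.
  by rewrite /f; case: pickP => [y /eqP/undel_inj//|/(_ x)]; rewrite eqxx.
have fv : f v = s'.
  by rewrite /f; case: pickP => // y /eqP ey; have := undel_neq y; rewrite ey eqxx.
have fM x y : adj x y -> connect (@adj H) (f x) (f y).
  have [->|xv] := eqVneq x v; first by rewrite vs => /eqP->; rewrite fv -es fK.
  have [->|yv] := eqVneq y v.
    by rewrite adj_sym vs => /eqP->; rewrite fv -es fK.
  have [x' <-] := undelP xv; have [y' <-] := undelP yv.
  by rewrite !fK => xy; apply: connect1.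
apply/connectedP => x y; have /connectP[p xp ey] := connectedP G cG (undel x) (undel y).
rewrite -(fK x) -(fK y) {}ey; elim: p (undel x) xp => [|z p IHp] u //=.
by case/andP=> /fM uz /IHp; apply: connect_trans.
Qed.

Lemma dist_undel (x y : H) : dist x y <= dist (undel x) (undel y).
Proof.
have cH := del_leaf_connected; have [s' es] := undelP svP.
(* The distance from [x] in [H] is extended to the leaf, which is reached only through [s]; the
   extension still varies by at most one along edges. *)
pose d (z : G) := if [pick z' | undel z' == z] is Some z' then dist x z' else (dist x s').+1.
have dK z : d (undel z) = dist x z.
  by rewrite /d; case: pickP => [z' /eqP/undel_inj->//|/(_ z)]; rewrite eqxx.
have dv : d v = (dist x s').+1.
  by rewrite /d; case: pickP => // z /eqP ez; have := undel_neq z; rewrite ez eqxx.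
rewrite -(dK y); apply: Lipschitz_le_dist; rewrite ?dK ?distxx //.
  exact: connectedP.
move=> u w; have [->|uv] := eqVneq u v.
  by rewrite vs => /eqP->; rewrite dv -es dK; lia.
have [->|wv] := eqVneq w v.
  by rewrite adj_sym vs => /eqP->; rewrite dv -es dK; lia.
have [u' <-] := undelP uv; have [w' <-] := undelP wv.
by rewrite undel_adj !dK; apply: dist_adjr.
Qed.

(** The leaf adds [dist u v] to the distance sum of [u], weighted by the eccentricity of [u], and
    has its own term, weighted by the eccentricity of [v]. The remaining distances and
    eccentricities in [H] are at most those in [G]. *)
Lemma ecc_dist_sum_del_leaf :
  ecc_dist_sum H + \sum_(u | u != v) (eccentricity u + eccentricity v) * dist u v
    <= ecc_dist_sum G.
Proof.
rewrite /ecc_dist_sum [X in _ <= X](bigD1 v) //=.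
have -> : eccentricity v * dist_sum v = \sum_(u | u != v) eccentricity v * dist u v.
  by rewrite /dist_sum (bigD1 v) //= distxx add0n big_distrr.
under [X in _ + X <= _]eq_bigr do rewrite mulnDl.
rewrite big_split /= addnA addnC leq_add2l -!sum_undel -big_split /=.
apply: leq_sum => x _; rewrite /dist_sum (bigD1 v) //= (dist_sym cG v) mulnDr addnC leq_add2l.
rewrite -sum_undel; apply: leq_mul; last by apply: leq_sum => y _; apply: dist_undel.
apply: ecc_leq => u; exact: leq_trans (dist_undel u x) (leq_ecc _ _).
Qed.

End LeafDeletion.

(** * Growth of the eccentric distance sum at a leaf *)

Section LeafIncrement.
Variables (G : sgraph) (v s : G).
Hypotheses (vs : forall x, adj v x = (x == s)) (uG : unicyclic G).

(** The degree sum drops by 2, once for [v] and once for [s], so exactly one edge disappears with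
    the vertex. *)
Lemma del_leaf_unicyclic : unicyclic (del_vertex v).
Proof.
have /andP[cG /eqP eG] := uG.
have svP : s != v by rewrite eq_sym adj_neq // vs.
apply/andP; split; first exact: del_leaf_connected vs cG.
rewrite -(eqn_pmul2l (m := 2)) // -sum_deg.
have := sum_deg G; rewrite -eG (bigD1 v) //= (deg_leaf vs) -sum_undel -(card_del_vertex v).
under eq_bigr do rewrite (deg_undel vs).
rewrite big_split /= (@sum_undel G v (fun x => nat_of_bool (x == s))).
have -> : \sum_(x | x != v) (x == s) = 1.
  by rewrite (bigD1 s) //= eqxx big1 // => x /andP[_ /negbTE->].
lia.
Qed.

Hypothesis deg_s : deg s + 2 <= #|G|.

Lemma exists_nonadjacent : exists2 w, w != s & ~~ adj s w.
Proof.
have: 0 < #|~: (s |: [set y | adj s y])|.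
  by rewrite cardsCs setCK cardsU1 inE adj_irrefl; have := deg_s; rewrite /deg; lia.
by case/card_gt0P => w; rewrite !inE negb_or => /andP[]; exists w.
Qed.

(* Two of three such neighbours x would hang on s by edges outside a tree of
   shortest paths to a vertex w not adjacent to s. *)
Lemma neighbours_of_ecc2 : #|[set x | adj s x & eccentricity x <= 2]| <= 2.
Proof.
have /andP[cG _] := uG; have [w ws sw] := exists_nonadjacent.
have dsw : 1 < dist s w by apply: dist_gt1; rewrite // eq_sym.
pose p x := odflt x [pick y | adj x y && (dist y w < dist x w)].
have pP x : x != w -> adj x (p x) /\ dist (p x) w < dist x w.
  move=> xw; rewrite /p; case: pickP => [y /andP[]//|h].
  by have [y xy lt] := exists_parent cG xw; have := h y; rewrite xy lt.
have [a [b [_ _ _ ab]]] := unicyclic_extra_edge uG pP.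
have: #|[set p s; if s == a then b else a]| <= 2 by rewrite cards2; case: (_ != _).
apply: leq_trans; apply: subset_leq_card; apply/subsetP => x.
rewrite !inE => /andP[sx ex]; have [[_ ->]|[xw sp]|[-> ->]|[-> ->]] := ab _ _ sx.
- by rewrite eqxx.
(* A neighbour whose parent is [s] is farther from [w] than [s], hence at distance at least 3 from
   [w]. *)
- have [_] := pP _ xw; rewrite -sp => lt.
  have := leq_ecc w x; rewrite dist_sym //; lia.
- by rewrite !eqxx orbT.
by have [->|_] := eqVneq b a; rewrite eqxx orbT.
Qed.

(* The vertex s contributes at least 5, a neighbour of s at least 12, or 10 when
   its eccentricity is 2, and every other vertex at least 18. *)
Lemma leaf_increment :
  18 * #|G| <= \sum_(u | u != v) (eccentricity u + eccentricity v) * dist u v + 6 * deg s + 29.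
Proof.
have /andP[cG _] := uG; have [w ws sw] := exists_nonadjacent.
have av : adj v s by rewrite vs.
have sv : s != v by rewrite eq_sym adj_neq.
have dv u : u != v -> u != s -> 1 < dist u v.
  by move=> uv us; apply: dist_gt1; rewrite // adj_sym vs.
have dv3 u : u != v -> u != s -> ~~ adj s u -> 2 < dist u v.
  move=> uv us su; rewrite dist_sym //.
  have [|y] := exists_parent cG (r := u) (x := v); first by rewrite eq_sym.
  by rewrite vs => /eqP->; apply: leq_trans; rewrite ltnS; apply: dist_gt1; rewrite // eq_sym.
have wv : w != v by apply: contraNneq sw => ->; rewrite adj_sym.
have ev : 2 < eccentricity v by apply: leq_trans (leq_ecc w v); apply: dv3.
have es : 1 < eccentricity s.
  by apply: leq_trans (leq_ecc w s); apply: dist_gt1; rewrite // adj_sym.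
have eu u : u != v -> u != s -> dist u v <= eccentricity u.
  by move=> uv us; rewrite dist_sym // leq_ecc.
pose X := [set x | adj s x & eccentricity x <= 2].
have: \sum_(u | u != v) 18 <= \sum_(u | u != v)
    ((eccentricity u + eccentricity v) * dist u v + 13 * (u == s) + 6 * adj s u + 2 * (u \in X)).
  apply: leq_sum => u uv; rewrite inE.
  have [->|us] := eqVneq u s.
    by rewrite (dist_adj cG) 1?adj_sym // adj_irrefl /=; lia.
  have := eu u uv us; case: (boolP (adj s u)) => su /=.
    have := dv u uv us; case: leqP => /= ? ?; nia.
  have := dv3 u uv us su; nia.
have distr k (F : G -> nat) : \sum_(u | u != v) k * F u = k * \sum_(u | u != v) F u.
  by rewrite big_distrr.
rewrite 3!big_split /= sum_nat_const (distr 13 (fun u => nat_of_bool (u == s))).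
rewrite (distr 6 (fun u => nat_of_bool (adj s u))) (distr 2 (fun u => nat_of_bool (u \in X))) /=.
have -> : \sum_(u | u != v) (u == s) = 1.
  by rewrite (bigD1 s) //= eqxx big1 // => u /andP[_ /negbTE->].
have -> : #|[pred u | u != v]| = #|G|.-1 by rewrite -(cardC1 v).
(* The leaf is a neighbour of [s] outside the sum. With F the sum of the lemma, the total reads 18
   (n - 1) <= F + 13 + 6 (deg s - 1) + 2 * 2, whence 29 = 18 + 13 - 6 + 4. *)
have : (\sum_(u | u != v) adj s u).+1 = deg s.
  rewrite /deg -sum1_card [RHS](bigD1 v) /=; last by rewrite inE adj_sym.
  rewrite add1n; congr _.+1; rewrite [LHS]big_mkcond [RHS]big_mkcond /=.
  by apply: eq_bigr => u _; rewrite inE; case: adj; case: (u != v).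
have : \sum_(u | u != v) (u \in X) <= #|X|.
  rewrite -sum1_card [X in X <= _]big_mkcond [X in _ <= X]big_mkcond /=.
  by apply: leq_sum => u _; case: (u \in X); case: (u != v).
have X2 : #|X| <= 2 := neighbours_of_ecc2.
move: X2 (\sum_(u | u != v) (u \in X)) (\sum_(u | u != v) adj s u) => X2 m k.
move: (\sum_(i | i != v) _) (deg s) X2 => F d; move: #|X| #|G|; clear; lia.
Qed.

End LeafIncrement.

(** * A leaf avoided by a maximum matching *)

Section UnmatchedLeaf.
Variable G : sgraph.
Implicit Types x y u v s : G.

Lemma disjoint_edges_mate (l : seq (G * G)) x : disjoint_edges l ->
  x \in pair_vertices l -> exists2 y, y \in pair_vertices l & adj x y.
Proof.
case/andP=> /allP al _; rewrite mem_cat => /orP[] /mapP[p pl ->].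
  by exists p.2; [rewrite mem_cat [X in _ || X]map_f ?orbT|apply: al].
by exists p.1; [rewrite mem_cat map_f|rewrite adj_sym; apply: al].
Qed.

(** The matching [l] avoids [v], so it survives in the smaller graph; the converse inequality is
    monotonicity. *)
Lemma del_unmatched_vertex v l :
  disjoint_edges l -> size l = matching_number G -> v \notin pair_vertices l ->
  matching_number (del_vertex v) = matching_number G.
Proof.
move=> /andP[al ul] sl vl; apply/eqP; rewrite eqn_leq; apply/andP; split.
  by apply: (matching_number_le (@undel_inj G v)).
have [l' el]: exists l', l = [seq (undel p.1, undel p.2) | p : del_vertex v * del_vertex v <- l'].
  elim: {al ul sl} l vl => [|[x y] l IHl]; first by exists [::].
  rewrite mem_pair_vertices_cons !negb_or => /and3P[vx vy /IHl[l' ->]].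
  have [x' ex] : exists x' : del_vertex v, undel x' = x by apply: undelP; rewrite eq_sym.
  have [y' ey] : exists y' : del_vertex v, undel y' = y by apply: undelP; rewrite eq_sym.
  by exists ((x', y') :: l'); rewrite /= ex ey.
apply/matching_numberP; exists l'; last by rewrite -sl el size_map.
move: al ul; rewrite {l sl vl}el /disjoint_edges all_map /pair_vertices /unzip1 /unzip2.
rewrite -!map_comp (map_comp (@undel G v) fst) (map_comp (@undel G v) snd) -map_cat.
by rewrite (map_inj_uniq (@undel_inj G v)) => -> ->.
Qed.

(* Otherwise the n - 2m unmatched vertices, which are independent, have degree
   at least 2, so that n >= m + 2 (n - 2m) by counting edges. *)
Lemma exists_unmatched_leaf :
  unicyclic G -> 0 < matching_number G -> 3 * matching_number G < #|G| ->
  exists v s, (forall x, adj v x = (x == s))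
    /\ matching_number (del_vertex v) = matching_number G.
Proof.
move=> /andP[cG /eqP eG] m0 big.
have /matching_numberP[l dl sl] := leqnn (matching_number G).
pose V := [set x in pair_vertices l].
have cV : #|V| = 2 * matching_number G.
  have /andP[_ /card_uniqP ul] := dl; rewrite cardsE ul size_pair_vertices sl //.
(* An edge between two unmatched vertices would enlarge the maximum matching. *)
have indep u x : u \notin V -> adj u x -> x \in V.
  rewrite !inE => uV ux; apply: contraLR (leqnn (matching_number G)) => xV.
  rewrite -ltnNge; apply/matching_numberP; exists ((u, x) :: l); last by rewrite /= sl.
  have /andP[al ul] := dl.
  by rewrite /disjoint_edges uniq_pair_vertices_cons /= ux al ul uV xV adj_neq.
have [v /andP[vV dv]|h] := pickP [pred v | (v \notin V) && (deg v <= 1)].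
  have /card_gt0P[w]: 0 < #|~: [set v]| by rewrite cardsC1; lia.
  rewrite !inE eq_sym => wv; have [s vs _] := exists_parent cG wv.
  have /cards1P[s' es] : #|[set x | adj v x]| == 1.
    rewrite eqn_leq dv; apply/card_gt0P; exists s; by rewrite inE.
  exists v, s'; split; last by apply: del_unmatched_vertex dl sl _; rewrite inE in vV.
  by move=> x; have /setP/(_ x) := es; rewrite !inE.
have dI u : u \notin V -> 1 < deg u by move=> uV; have := h u; rewrite inE uV /= ltnNge => ->.
have degV (A : {set G}) x : #|[set y in A | adj x y]| = \sum_(y in A) adj x y.
  rewrite -sum1_card big_mkcond [RHS]big_mkcond /=; apply: eq_bigr => y _.
  by rewrite inE; case: (y \in A); case: adj.
have eI : \sum_(x in V) \sum_(y in ~: V) adj x y = \sum_(y in ~: V) deg y.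
  rewrite exchange_big /=; apply: eq_bigr => y; rewrite inE => yV.
  under eq_bigr do rewrite adj_sym; rewrite -degV; apply: eq_card => x; rewrite !inE.
  by case: (boolP (adj y x)) => [/(indep _ _ yV)|]; rewrite ?andbF // inE => ->.
(* Besides its unmatched neighbours, a matched vertex has its mate, which lies in [V]. *)
have dV x : x \in V -> 1 + \sum_(y in ~: V) adj x y <= deg x.
  move=> xV; rewrite -degV.
  have [y yV xy] : exists2 y, y \in V & adj x y.
    by rewrite inE in xV; have [y yl xy] := disjoint_edges_mate dl xV; exists y; rewrite ?inE.
  have <- : #|y |: [set y in ~: V | adj x y]| = 1 + #|[set y in ~: V | adj x y]|.
    by rewrite cardsU1 !inE negb_and negbK -[y \in pair_vertices l]in_set -/V yV.
  apply/subset_leq_card/subsetP => z; rewrite !inE => /orP[/eqP->//|/andP[]//].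
(* With D the degree sum outside [V], D >= 2 (n - 2m) and the degree sum over [V] is at least 2m +
   D. Hence 2n >= 2m + 4 (n - 2m), that is n <= 3m. *)
have := leq_sum (index_enum G) dV; rewrite big_split /= eI sum1_card.
have : \sum_(u in ~: V) 2 <= \sum_(u in ~: V) deg u.
  by apply: leq_sum => u; rewrite inE => /dI.
rewrite sum_nat_const [#|~: V|]cardsCs setCK cV.
have := sum_deg G; rewrite -eG (bigID (mem V)) /=.
rewrite [\sum_(i | _ \notin _) _](eq_bigl (mem (~: V))); last by move=> u; rewrite /= in_setC.
move: (\sum_(i in V) _) (\sum_(i in ~: V) _) big => a b.
by move: (matching_number G) #|G| => m n; clear; lia.
Qed.

End UnmatchedLeaf.

(** * Enumeration of small unicyclic graphs *)

Definition adjb (s : seq (nat * nat)) (i j : nat) := ((i, j) \in s) || ((j, i) \in s).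

Lemma adjb_sym s : symmetric (adjb s).
Proof. by move=> i j; rewrite /adjb orbC. Qed.

Lemma list_graph_iso (G : sgraph) (x0 : G) (q : seq G) n s :
    uniq q -> size q = n -> #|G| = n ->
    (forall i j, i < n -> j < n -> i != j ->
       adj (nth x0 q i) (nth x0 q j) = adjb s i j) ->
  isomorphic G (list_graph n s).
Proof.
move=> uq sq cG qs; apply: isomorphic_sym.
exists (fun i : list_graph n s => nth x0 q i).
  apply: inj_card_bij; last by rewrite /= card_ord cG.
  by move=> i j /eqP; rewrite nth_uniq ?sq // => /eqP/val_inj.
move=> i j; rewrite [RHS]/= /list_adj; have [->|ij] := eqVneq i j; first exact: adj_irrefl.
by rewrite qs.
Qed.

(* Nondecreasing lists ps of the parents of the vertices 1, ..., k in a
   breadth-first order: ps_i is the parent of i + 1. *)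
Fixpoint parents k : seq (seq nat) :=
  if k is k'.+1
  then [seq rcons ps j | ps <- parents k', j <- iota (last 0 ps) (k - last 0 ps)]
  else [:: [::]].

Lemma size_parents k ps : ps \in parents k -> size ps = k.
Proof.
elim: k ps => [|k IHk] ps; first by rewrite inE => /eqP->.
by move/allpairsPdep => [qs [j [/IHk <- _ ->]]]; rewrite size_rcons.
Qed.

Lemma parents_lt k ps i : ps \in parents k -> i < k -> nth 0 ps i <= i.
Proof.
elim: k ps => // k IHk _ /allpairsPdep[ps [j [ps_k jk ->]]].
rewrite ltnS leq_eqVlt nth_rcons (size_parents ps_k) => /orP[/eqP->|ik].
  by rewrite ltnn eqxx; move: jk; rewrite mem_iota; lia.
by rewrite ik; apply: IHk.
Qed.

Definition tree_edges (ps : seq nat) := zip ps (iota 1 (size ps)).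

Lemma mem_tree_edges ps i j :
  (i, j) \in tree_edges ps = [&& 0 < j, j <= size ps & i == nth 0 ps j.-1].
Proof.
have sz : size ps = size (iota 1 (size ps)) by rewrite size_iota.
apply/idP/and3P => [|[j0 js /eqP->]].
  move=> /(nthP (0, 0))[k]; rewrite size_zip size_iota minnn => ks.
  by rewrite nth_zip // nth_iota // => -[<- <-] /=.
case: j j0 js => // j _ js; apply/(nthP (0, 0)); exists j.
  by rewrite size_zip size_iota minnn.
by rewrite nth_zip // nth_iota.
Qed.

(* The next vertex is chosen adjacent to the earliest possible visited vertex,
   so that the parents come in nondecreasing order. *)
Lemma bfs_order (G : sgraph) (x0 : G) k : connected G -> k < #|G| ->
  exists q ps, [/\ uniq q, size q = k.+1, ps \in parents k,
    forall i, i < k -> adj (nth x0 q (nth 0 ps i)) (nth x0 q i.+1) &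
    forall y j, y \notin q -> j < last 0 ps -> ~~ adj (nth x0 q j) y].
Proof.
move=> cG; elim: k => [_|k IHk kG]; first by exists [:: x0], [::].
have [q [ps [uq sq psk psq qmin]]] := IHk (ltnW kG).
pose P j := (j < size q) && [exists y, (y \notin q) && adj (nth x0 q j) y].
have exP : exists j, P j.
  case: (boolP (has P (iota 0 (size q)))) => [/hasP[j _ Pj]|/hasPn nP]; first by exists j.
  (* If no visited vertex had an unvisited neighbour, [q] would be closed under adjacency and still
     miss [z], against connectedness. *)
  have [z /= zq|all_q] := pickP (predC (mem q)); last first.
    suff: #|G| <= size q by rewrite sq; lia.
    rewrite -(card_uniqP uq); apply/subset_leq_card/subsetP => z _.
    by have := all_q z => /negbFE.
  have cl : closed (@adj G) (mem q).
    apply: intro_closed; first exact/sym_connect_sym/adj_sym.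
    move=> x y xy xq; apply: contraT => yq; have iq : index x q < size q by rewrite index_mem.
    have := nP (index x q); rewrite mem_iota /P iq nth_index // => /(_ isT)/existsP[].
    by exists y; rewrite yq xy.
  have q0 : nth x0 q 0 \in q by rewrite mem_nth ?sq.
  have /connectedP/(_ (nth x0 q 0) z)/(closed_connect cl) := cG.
  by move=> e; case/negP: zq; apply: etrans (esym e) q0.
case: (ex_minnP exP) => j /andP[jq /existsP[y /andP[yq jy]]] jmin.
have jk : j < k.+1 by rewrite -sq.
(* Vertices before the last parent have no unvisited neighbour left, so the new parent does not
   precede it. *)
have lastj : last 0 ps <= j by rewrite leqNgt; apply: contraL jy; apply: qmin.
exists (rcons q y), (rcons ps j); split.
- by rewrite rcons_uniq yq.
- by rewrite size_rcons sq.
- by apply/allpairsPdep; exists ps, j; split=> //; rewrite mem_iota; lia.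
- move=> i; rewrite ltnS leq_eqVlt !nth_rcons (size_parents psk) sq => /orP[/eqP->|ik].
    by rewrite ltnn eqxx jk ltnn eqxx.
  by rewrite ik (leq_ltn_trans (parents_lt psk ik)) ?ltnS ?ik ?psq // ltnW.
move=> z i; rewrite mem_rcons inE negb_or last_rcons => /andP[zy zq] ij.
rewrite nth_rcons sq (ltn_trans ij jk); apply/negP => iz.
suff: j <= i by rewrite leqNgt ij.
by apply: jmin; rewrite /P sq (ltn_trans ij jk); apply/existsP; exists z; rewrite zq.
Qed.

(** A breadth-first order supplies the tree; with the position in it as rank, [unicyclic_extra_edge]
    supplies the remaining edge. *)
Lemma unicyclic_list_graph (G : sgraph) n : unicyclic G -> #|G| = n.+1 ->
  exists ps a b, [/\ ps \in parents n, a < b < n.+1, (a, b) \notin tree_edges ps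
    & isomorphic G (list_graph n.+1 ((a, b) :: tree_edges ps))].
Proof.
move=> uG cG; have /andP[conG _] := uG.
have /card_gt0P[x0 _] : 0 < #|G| by rewrite cG.
have [|q [ps [uq sq psn psq _]]] := bfs_order (k := n) x0 conG; first by rewrite cG.
have qE x : x \in q.
  apply: contraT => xq; have /card_uniqP ux : uniq (x :: q) by rewrite /= xq.
  by have := max_card (mem (x :: q)); rewrite ux cG /= sq ltnn.
pose r := nth x0 q 0; pose rk x := index x q.
pose p x := nth x0 q (nth 0 ps (rk x).-1).
have rkq i : i < n.+1 -> rk (nth x0 q i) = i by move=> ni; rewrite /rk index_uniq ?sq.
have rkn x : rk x < n.+1 by rewrite -sq index_mem.
have qrk x : nth x0 q (rk x) = x by apply: nth_index.
have rk_inj : injective rk by move=> x y e; rewrite -(qrk x) e qrk.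
have rkr x : x != r -> 0 < rk x.
  by apply: contraNltn; rewrite leqn0 => /eqP e; rewrite -(qrk x) e.
have rkp x : x != r -> rk (p x) = nth 0 ps (rk x).-1 /\ nth 0 ps (rk x).-1 < rk x.
  move=> /rkr xr; have := rkn x; have := @parents_lt _ _ (rk x).-1 psn => h1 h2.
  by rewrite /p rkq; [split=> //|]; case: (rk x) xr h1 h2 => //= i _ h1 h2; have := h1 h2; lia.
have [x /[dup] xr /rkp[e lt]|a [b [ab na nb abP]]] := @unicyclic_extra_edge G r p rk uG.
  split; last by rewrite e.
  have := rkn x; have x1 := rkr _ xr; have := psq (rk x).-1.
  rewrite prednK // qrk adj_sym => h1 h2; apply: h1; lia.
(* By symmetry the extra edge is oriented upwards, the only way in which the enumeration lists
   it. *)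
wlog lab : a b ab na nb abP / rk a < rk b.
  move=> h; have : rk a != rk b by apply: contra_neq (adj_neq ab) => /rk_inj.
  rewrite neq_ltn => /orP[/h|/h]; apply=> //; first by rewrite adj_sym.
  by move=> x y /abP[]; [apply: Or41|apply: Or42|apply: Or44|apply: Or43].
exists ps, (rk a), (rk b); split=> //; first by rewrite lab rkn.
  rewrite mem_tree_edges; apply/negP => /and3P[b0 _ /eqP e].
  have br : b != r by apply: contraTneq b0 => ->; rewrite /rk /r index_uniq ?sq.
  by case/eqP: (nb br); rewrite /p -e qrk.
have treeE i j : i < n.+1 -> j < n.+1 -> (i, j) \in tree_edges ps ->
    adj (nth x0 q i) (nth x0 q j).
  rewrite mem_tree_edges => _ jn /and3P[j0 _ /eqP->].
  by rewrite -{2}(prednK j0); apply: psq; lia.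
apply: (list_graph_iso (x0 := x0) uq sq cG) => i j ni nj _.
have [/abP|] := boolP (adj (nth x0 q i) (nth x0 q j)); rewrite /adjb !in_cons.
  have sps := size_parents psn.
  case=> [[xr e]|[xr e]|[<- <-]|[<- <-]]; rewrite ?rkq ?eqxx ?orbT //.
    have [e1 lt] := rkp _ xr; move: e1 lt; rewrite -e !rkq // => -> lt.
    by rewrite [(nth _ _ _, i) \in _]mem_tree_edges sps eqxx andbT; move: lt ni; case: (i) => // k; rewrite /= !ltnS => _ ->; rewrite !orbT.
  have [e1 lt] := rkp _ xr; move: e1 lt; rewrite -e !rkq // => -> lt.
  by rewrite [(nth _ _ _, j) \in _]mem_tree_edges sps eqxx andbT; move: lt nj; case: (j) => // k; rewrite /= !ltnS => _ ->; rewrite !orbT.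
move=> nij; apply/esym/negP => /orP[/orP[/eqP[ei ej]|/treeE]|/orP[/eqP[ej ei]|/treeE]].
- by case/negP: nij; rewrite ei ej !qrk.
- by move=> h; case/negP: nij; apply: h.
- by case/negP: nij; rewrite ei ej !qrk adj_sym.
by move=> h; case/negP: nij; rewrite adj_sym; apply: h.
Qed.

(** * Executable tests on edge lists *)

Section Computation.
Variable n : nat.
Implicit Types s t : seq (nat * nat).

Definition valid s := all (fun p => [&& p.1 != p.2, p.1 < n & p.2 < n]) s.

Fixpoint max_matching (used : seq nat) s :=
  if s is (a, b) :: s' then
    let m := max_matching used s' in
    if (a \in used) || (b \in used) then m
    else maxn m (max_matching [:: a, b & used] s').+1
  else 0.

(* Unlike [has], this stops at the first success under call by value. *)
Fixpoint lazy_has (T : Type) (p : pred T) l :=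
  if l is x :: l' then if p x then true else lazy_has p l' else false.

Definition degb s i := count (fun p => (p.1 == i) || (p.2 == i)) s.

(* Comparing degrees only prunes the search. *)
Definition consistent s t (m : seq nat) j :=
  [&& j \notin m, degb s (size m) == degb t j &
  all (fun k => adjb s (size m) k == adjb t j (nth 0 m k)) (iota 0 (size m))].

(** Backtracking search: [m] lists the images in [t] of the first vertices of [s], and [fuel] is the
    number of images still to be chosen. *)
Fixpoint extends_to_iso s t fuel (m : seq nat) :=
  if fuel is f.+1 then
    lazy_has (fun j => if consistent s t m j then extends_to_iso s t f (rcons m j) else false)
      (iota 0 n)
  else true.

(** On a tree distance matrix: a leaf hung on [p] is one step farther than [p] from every old
    vertex. *)
Definition add_leaf_row (M : seq (seq nat)) p :=
  rcons [seq rcons d (nth 0 d p).+1 | d <- M] (rcons (map S (nth [::] M p)) 0).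

Definition tree_matrix (ps : seq nat) := foldl add_leaf_row [:: [:: 0]] ps.

Fixpoint map2 (f : nat -> nat -> nat) (l l' : seq nat) :=
  match l, l' with x :: l, y :: l' => f x y :: map2 f l l' | _, _ => [::] end.

(** Meant as the distance row once the edge between [a] and [b] joins a tree with matrix [M]: a
    shortest walk crosses that edge at most once, starting from its end nearer to the source. *)
Definition shortcut (M : seq (seq nat)) a b d :=
  let x := nth 0 d a in let y := nth 0 d b in
  if x.+1 < y then map2 (fun u v => minn u (x.+1 + v)) d (nth [::] M b)
  else if y.+1 < x then map2 (fun u v => minn u (y.+1 + v)) d (nth [::] M a)
  else d.

(* Certifies that d is a lower bound for the distances from vertex i, whatever
   the way d was computed. *)
Definition Lipschitz_row s i (d : seq nat) :=
  [&& eqn (size d) n, eqn (nth 0 d i) 0 &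
  all (fun e => let: (a, b) := e in
    let x := nth 0 d a in let y := nth 0 d b in (x <= y.+1) && (y <= x.+1)) s].

(** Rows that fail the certificate count 0, so the bound is sound for an arbitrary [M]. *)
Definition eds_lower_bound s (M : seq (seq nat)) :=
  sumn [seq let d := nth [::] M i in
        if Lipschitz_row s i d then foldr maxn 0 d * sumn d else 0 | i <- iota 0 n].

(** The numerical test comes before the costlier searches. Rejecting a graph by its matching number
    requires [valid s], under which [max_matching] is that number. *)
Definition check (ts : seq (seq (nat * nat))) s M :=
  if (6 * n ^ 2 <= eds_lower_bound s M + 5 * n + 44)
     && all (fun i => degb s i + 3 <= n) (iota 0 n) then true
  else if (max_matching [::] s != 3) then valid s
  else lazy_has (fun t => extends_to_iso s t n [::]) ts.

Definition check_all ts :=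
  all (fun ps => let t := tree_edges ps in let M := tree_matrix ps in
    all (fun b => all (fun a => if (a, b) \in t then true
                                else check ts ((a, b) :: t) (map (shortcut M a b) M))
                      (iota 0 b)) (iota 0 n)) (parents n.-1).

End Computation.

(** * Correctness of the enumeration *)

Lemma lazy_hasE (T : Type) (p : pred T) l : lazy_has p l = has p l.
Proof. by elim: l => //= x l ->; case: (p x). Qed.

Lemma perm_pair_vertices (T : eqType) (l l' : seq (T * T)) :
  perm_eq l l' -> perm_eq (pair_vertices l) (pair_vertices l').
Proof. by move=> ll'; apply: perm_cat; apply: perm_map. Qed.

(** Induction on [s]: either its first edge is not in [l], or it is removed from [l] and its ends
    become used vertices. *)
Lemma max_matching_ge used s (l : seq (nat * nat)) :
    {subset l <= s} -> uniq (pair_vertices l) ->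
    {in pair_vertices l, forall x, x \notin used} ->
  size l <= max_matching used s.
Proof.
elim: s used l => [|[a b] s IHs] used l ls ul lu.
  by case: l ls {ul lu} => // e l /(_ e); rewrite inE eqxx => /(_ isT).
have [abl|abl] := boolP ((a, b) \in l); last first.
  have ls' : {subset l <= s}.
    by move=> e el; have := ls _ el; rewrite inE => /orP[/eqP ee|//]; rewrite -ee el in abl.
  by have /= := IHs _ _ ls' ul lu; case: ifP => // _; rewrite leq_max => ->.
have pl := perm_pair_vertices (perm_to_rem abl).
move: ul; rewrite (perm_uniq pl) uniq_pair_vertices_cons => /and4P[ab na nb ul].
have lu' x : x \in [:: a, b & pair_vertices (rem (a, b) l)] -> x \notin used.
  by rewrite -(perm_mem (pair_vertices_cons _ _ _)) -(perm_mem pl); apply: lu.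
rewrite /= (negbTE (lu' a _)) ?(negbTE (lu' b _)) ?inE ?eqxx ?orbT //= leq_max.
apply/orP; right; rewrite (perm_size (perm_to_rem abl)) ltnS; apply: IHs => //.
  move=> [c d] cd; have := ls _ (mem_rem cd); rewrite inE => /orP[/eqP ee|//].
  by case/negP: na; rewrite mem_cat; apply/orP; left; apply/mapP; exists (c, d) => //; case: ee.
move=> x xl; rewrite !inE !negb_or lu' ?inE ?xl ?orbT // andbT.
by apply/andP; split; apply: contraTneq xl => ->.
Qed.

Lemma max_matching_ex n used s : valid n s -> exists l : seq (nat * nat),
  [/\ {subset l <= s}, uniq (pair_vertices l),
      {in pair_vertices l, forall x, x \notin used} & size l = max_matching used s].
Proof.
elim: s used => [|[a b] s IHs] used /=; first by exists [::].
case/andP=> /and3P[/= ab _ _] vs.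
have [l [ls ul lu sl]] := IHs used vs.
have [l' [ls' ul' lu' sl']] := IHs [:: a, b & used] vs.
have skip : exists l : seq (nat * nat), [/\ {subset l <= (a, b) :: s}, uniq (pair_vertices l),
    {in pair_vertices l, forall x, x \notin used} & size l = max_matching used s].
  by exists l; split=> // e /ls; rewrite inE orbC => ->.
case: ifP => [//|/negbT]; rewrite negb_or => /andP[au bu].
case: leqP => // _; exists ((a, b) :: l'); split.
- by move=> e; rewrite !inE => /orP[->//|/ls' ->]; rewrite orbT.
- rewrite uniq_pair_vertices_cons ab ul' andbT /=.
  by apply/andP; split; apply/negP => /lu'; rewrite !inE eqxx ?orbT.
- move=> x; rewrite mem_pair_vertices_cons => /or3P[/eqP->//|/eqP->//|/lu'].
  by rewrite !inE !negb_or => /and3P[].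
by rewrite /= sl'.
Qed.

Lemma matching_number_list_graph n s : valid n s ->
  matching_number (list_graph n s) = max_matching [::] s.
Proof.
move=> vs; apply/eqP; rewrite eqn_leq; apply/andP; split.
  have /matching_numberP[l /andP[al ul] <-] := leqnn (matching_number (list_graph n s)).
  (* Each matching edge is oriented the way [s] lists it. *)
  pose o (p : 'I_n * 'I_n) := if (val p.1, val p.2) \in s then (val p.1, val p.2)
                              else (val p.2, val p.1).
  have pl : perm_eq (pair_vertices (map o l)) (map val (pair_vertices l)).
    elim: l {al ul} => //= -[x y] l IHl.
    have := pair_vertices_cons x y l; move/(perm_map val)/perm_trans/(_ (perm_refl _)).
    rewrite perm_sym => h; rewrite perm_sym; move: h; rewrite perm_sym => /perm_trans; apply.
    rewrite perm_sym /o /=; case: ifP => _; apply: perm_trans (pair_vertices_cons _ _ _) _.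
      by rewrite /= !perm_cons.
    by rewrite -[_ :: _ :: pair_vertices _]/([:: val y] ++ [:: val x] ++ _) perm_catCA /= !perm_cons.
  rewrite -(size_map o); apply: max_matching_ge => //.
    move=> e /mapP[p /(allP al) /andP[_ /=]]; rewrite /o.
    by case: ifP => [e1 _ ->|_ /= e2 ->].
  by rewrite (perm_uniq pl) map_inj_uniq //; apply: val_inj.
have [l [ls ul _ <-]] := max_matching_ex [::] vs.
apply/matching_numberP.
have [l' el] : exists l', l = [seq (val p.1, val p.2) | p : list_graph n s * list_graph n s <- l'].
  elim: {ul} l ls => [|[x y] l IHl] ls; first by exists [::].
  have [|l' ->] := IHl; first by move=> e el; apply: ls; rewrite inE el orbT.
  have /(allP vs)/and3P[/= _ xn yn] := ls _ (mem_head _ _).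
  by exists ((Ordinal xn, Ordinal yn) :: l').
exists l'; last by rewrite el size_map.
move: ul ls; rewrite el /pair_vertices /unzip1 /unzip2 -!map_comp.
rewrite (map_comp val fst) (map_comp val snd) -map_cat map_inj_uniq => [ul ls|]; last exact: val_inj.
rewrite /disjoint_edges /pair_vertices ul andbT; apply/allP => p pl.
have := map_f (fun p => (val p.1, val p.2)) pl => /ls ps.
by rewrite /= /list_adj ps andbT; have /and3P[] := allP vs _ ps.
Qed.

(** A completed search yields [n] distinct images below [n], hence a bijection, and each image was
    compared with all earlier ones. *)
Lemma extends_to_iso_sound n s t : extends_to_iso n s t n [::] ->
  isomorphic (list_graph n s) (list_graph n t).
Proof.
pose good_map m := [/\ uniq m, {subset m <= gtn n} & forall k i, k < i -> i < size m ->
  adjb s i k = adjb t (nth 0 m i) (nth 0 m k)].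
have ext fuel m : good_map m -> size m + fuel = n -> extends_to_iso n s t fuel m ->
    exists2 m', good_map m' & size m' = n.
  elim: fuel m => [|f IHf] m gm sm /=; first by exists m; rewrite // -sm addn0.
  rewrite lazy_hasE => /hasP[j]; rewrite mem_iota => jn.
  case: ifP => // /and3P[jm _ /allP cj]; apply: IHf; last by rewrite size_rcons; lia.
  case: gm => um mn am; split; first by rewrite rcons_uniq jm.
    by move=> x; rewrite mem_rcons inE => /orP[/eqP->|/mn].
  move=> k i ki; rewrite size_rcons ltnS !nth_rcons leq_eqVlt => /orP[/eqP ei|im].
    by rewrite ei in ki *; rewrite ltnn eqxx ki; apply/eqP/cj; rewrite mem_iota.
  by rewrite im (ltn_trans ki im) am.
case/ext => // m [um mn am] sm.
pose f (i : list_graph n s) : list_graph n t := insubd i (nth 0 m i).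
have fE i : val (f i) = nth 0 m i.
  by rewrite insubdK //; apply: mn; rewrite mem_nth // sm.
exists f.
  apply: inj_card_bij; rewrite /= ?card_ord // => i j /(congr1 val); rewrite !fE => /eqP.
  by rewrite nth_uniq ?sm // => /eqP/val_inj.
have fM (i j : list_graph n s) : i < j -> adj (f i) (f j) = adj i j.
  move=> ij; rewrite /= /list_adj -!(inj_eq val_inj) !fE nth_uniq ?sm // (ltn_eqF ij) /=.
  by rewrite -!/(adjb _ _ _) adjb_sym -am ?sm // adjb_sym.
move=> i j; case: (ltngtP i j) => [/fM//|/fM e|/val_inj->]; first by rewrite adj_sym e adj_sym.
by rewrite !adj_irrefl.
Qed.

(** Distinct neighbours come from distinct entries of [s]. Equality may fail, since [degb] counts
    repeated entries repeatedly. *)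
Lemma degb_ge n s (i : list_graph n s) : deg i <= degb s i.
Proof.
pose other (p : nat * nat) := if p.1 == i then p.2 else p.1.
pose l := map other (filter (fun p : nat * nat => (p.1 == i) || (p.2 == i)) s).
rewrite /degb -size_filter -(size_map other) -/l /deg cardE -(size_map val).
apply: uniq_leq_size => [|j]; first by rewrite map_inj_uniq ?enum_uniq //; apply: val_inj.
case/mapP=> x; rewrite mem_enum inE => /andP[ix sx] ->{j}.
case/orP: sx => sx; apply/mapP.
  by exists (val i, val x); rewrite ?mem_filter ?sx ?eqxx // /other eqxx.
exists (val x, val i); rewrite ?mem_filter ?sx ?eqxx ?orbT // /other.
by rewrite (inj_eq val_inj) eq_sym (negbTE ix).
Qed.

Lemma sumn_iota n (F : nat -> nat) : sumn [seq F i | i <- iota 0 n] = \sum_(i < n) F i.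
Proof. by rewrite sumnE big_map -(big_mkord xpredT) /index_iota subn0. Qed.

Lemma eds_lower_boundP n s M : connected (list_graph n s) ->
  eds_lower_bound n s M <= ecc_dist_sum (list_graph n s).
Proof.
move=> cG; rewrite /eds_lower_bound sumn_iota; apply: leq_sum => i _.
set d := nth [::] M i; case: ifP => //; rewrite /Lipschitz_row !eqnE => /and3P[/eqP sd /eqP d0 /allP ds].
have dL (u : list_graph n s) : nth 0 d u <= dist u i.
  rewrite dist_sym //; apply: (@Lipschitz_le_dist (list_graph n s) (fun u => nth 0 d u)) => //.
    exact: connectedP.
  by move=> x y /andP[_ /orP[] /ds /andP[]].
apply: leq_mul.
  rewrite foldrE (big_nth 0) big_mkord sd; apply/bigmax_leqP => u _.
  exact: leq_trans (dL u) (leq_ecc _ _).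
rewrite sumnE (big_nth 0) big_mkord sd; apply: leq_sum => u _; exact: dL.
Qed.

(* 6n^2-5n-44 exceeds the values 6n^2-5n-53 and 6n^2-5n-45 of U3' and U3star,
   and for n >= 8 also the value 6n^2-9n-14 of U3. *)
Definition far_from_extremal (n : nat) (G : sgraph) :=
  6 * n ^ 2 <= ecc_dist_sum G + 5 * n + 44 /\ forall x : G, deg x + 3 <= n.

Lemma far_from_extremal_iso n G H : connected G -> isomorphic G H ->
  far_from_extremal n H -> far_from_extremal n G.
Proof.
move=> cG GH [xiH dH]; split; first by rewrite (ecc_dist_sum_iso cG GH).
by case: GH => f fB fM x; rewrite -(deg_iso x fB fM).
Qed.

Lemma check_sound n ts s M : connected (list_graph n s) ->
    matching_number (list_graph n s) = 3 -> check n ts s M ->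
  far_from_extremal n (list_graph n s) \/
  exists2 t, t \in ts & isomorphic (list_graph n s) (list_graph n t).
Proof.
move=> cG mG; rewrite /check; case: ifP => [/andP[xi /allP dg] _|_].
  left; split; first by apply: leq_trans xi _; rewrite !leq_add2r eds_lower_boundP.
  move=> i; apply: leq_trans (_ : degb s i + 3 <= n); first by rewrite leq_add2r degb_ge.
  by apply: dg; rewrite mem_iota /= add0n.
case: ifP => [m3 /matching_number_list_graph|_].
  by rewrite mG => e; rewrite -e in m3.
by rewrite lazy_hasE => /hasP[t tts /extends_to_iso_sound]; right; exists t.
Qed.

Lemma check_all_sound n ts G : check_all n.+1 ts -> unicyclic_class n.+1 3 G ->
  far_from_extremal n.+1 G \/ exists2 t, t \in ts & isomorphic G (list_graph n.+1 t).
Proof.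
move=> /allP chk [uG cG mG]; have /andP[conG _] := uG.
have [ps [a [b [/chk chk' /andP[ab bn] nab iso]]]] := unicyclic_list_graph uG cG.
move: chk' => /allP/(_ b); rewrite mem_iota add0n => /(_ bn)/allP/(_ a).
rewrite mem_iota add0n => /(_ ab); rewrite (negbTE nab).
have conL : connected (list_graph n.+1 ((a, b) :: tree_edges ps)).
  by case: iso => f fB fM; apply: connected_iso fB fM conG.
case/check_sound => //; first by rewrite -(matching_number_iso iso).
  by left; apply: far_from_extremal_iso iso _.
by case=> t tts iso'; right; exists t => //; apply: isomorphic_trans iso iso'.
Qed.

(** * Graphs with pendant vertices attached to one vertex *)

Lemma mem_pendants n i j : ((i, j) \in pendants n) = (i == 0) && (4 < j < n).
Proof.
apply/mapP/andP => [[k]|[/eqP-> jn]].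
  by rewrite mem_iota => kn [-> ->]; split=> //; lia.
by exists j; rewrite // mem_iota; lia.
Qed.

(** Following predecessors backwards gives a walk of length [d i j]; the Lipschitz condition shows
    that none is shorter. *)
Lemma connected_dist n (s : seq (nat * nat)) (d : nat -> nat -> nat) :
    (forall i, i < n -> d i i = 0) ->
    (forall i a b, i < n -> a < n -> b < n -> (a, b) \in s ->
       d i b <= (d i a).+1 /\ d i a <= (d i b).+1) ->
    (forall i j, i < n -> j < n -> i != j ->
       exists k, [/\ k < n, k != j, adjb s k j & d i j = (d i k).+1]) ->
  connected (list_graph n s) /\ forall i j : list_graph n s, dist i j = d i j.
Proof.
move=> d0 dL dP.
have walk m (i j : list_graph n s) : d i j = m -> has_walk m i j.
  elim: m j => [|m IHm] j dij; have [ij|ij] := eqVneq i j.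
  - by apply/has_walkP; exists [::].
  - by have [k []] := dP i j (ltn_ord i) (ltn_ord j) ij; rewrite dij.
  - by move: dij; rewrite ij d0.
  have [k [kn kj kjs dk]] := dP i j (ltn_ord i) (ltn_ord j) ij.
  apply: (@has_walk_rcons (list_graph n s) m i (Ordinal kn) j); last by rewrite /= /list_adj -(inj_eq val_inj) kj.
  by apply: IHm => /=; lia.
have cG : connected (list_graph n s).
  apply/connectedP => i j; have /has_walkP[p [ip <- _]] := walk _ i j (erefl _).
  by apply/connectP; exists p.
split=> // i j; apply/eqP; rewrite eqn_leq dist_min ?walk //=.
apply: (@Lipschitz_le_dist (list_graph n s) (fun j => d i j)); first exact: connectedP.
  exact: d0.
by move=> a b /andP[_ /orP[]] /dL; case/(_ i (ltn_ord i) (ltn_ord _) (ltn_ord _)).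
Qed.

Definition core_graph n t := list_graph n (t ++ pendants n).

(* T is the distance table of the vertices 0, ..., 4 and of one pendant vertex,
   numbered 5, with T 5 5 the distance of two distinct pendant vertices. *)
Definition entry (T : seq (seq nat)) c j := nth 0 (nth [::] T c) j.

Definition table_dist T i j := if i == j then 0 else entry T (minn i 5) (minn j 5).

(** The hypotheses of [connected_dist] reduced to finitely many cases: all pendant vertices behave
    like 5 and are reached through 0. *)
Definition core_ok t T :=
  [&& all (fun e => [&& e.1 != e.2, e.1 < 5 & e.2 < 5]) t,
      all (fun c => entry T c 5 == (entry T c 0).+1) (iota 0 6),
      entry T 5 0 == 1, all (fun c => entry T c c == 0) (iota 0 5),
      all (fun c => all (fun e => (entry T c e.1 <= (entry T c e.2).+1) &&
                                  (entry T c e.2 <= (entry T c e.1).+1)) t) (iota 0 6) &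
      all (fun c => all (fun j => [|| c == j, (c == 5) && (j == 0) |
        has (fun k => [&& k != j, adjb t k j & entry T c j == (entry T c k).+1]) (iota 0 5)])
        (iota 0 5)) (iota 0 6)].

Lemma core_dist n t T : 5 <= n -> core_ok t T ->
  connected (core_graph n t) /\ forall i j : core_graph n t, dist i j = table_dist T i j.
Proof.
move=> n5 /and5P[/allP tP /allP T5 /eqP T50 /allP T0 /andP[/allP TL /allP TP]].
have c6 i : minn i 5 \in iota 0 6 by rewrite mem_iota; lia.
have tdd i : table_dist T i i = 0 by rewrite /table_dist eqxx.
have tdE i j : j < 5 -> table_dist T i j = entry T (minn i 5) j.
  move=> j5; rewrite /table_dist (minn_idPl (ltnW j5)); case: eqVneq => // ->.
  by rewrite (minn_idPl (ltnW j5)) (eqP (T0 j _)) // mem_iota.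
have td5 i j : 4 < j -> i != j -> table_dist T i j = (entry T (minn i 5) 0).+1.
  by move=> j5 ij; rewrite /table_dist (negbTE ij) (minn_idPr j5) (eqP (T5 _ (c6 i))).
apply: connected_dist => [i _|i a b _ an bn|i j i_n jn ij].
- exact: tdd.
- rewrite mem_cat mem_pendants => /orP[ab|/and3P[/eqP a0 b5 _]].
    have /and3P[_ /= a5 b5] := tP _ ab.
    by rewrite !tdE //; have /allP/(_ _ ab)/andP[] := TL _ (c6 i).
  rewrite a0; have [->|ib] := eqVneq i b.
    by rewrite tdd tdE // (minn_idPr b5) T50.
  rewrite (tdE _ 0) // td5 //; lia.
have [j5|j5] := leqP j 4; last first.
  exists 0; split; [lia|lia| |by rewrite td5 // tdE].
  by rewrite /adjb mem_cat mem_pendants j5 jn orbT.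
have := TP _ (c6 i) => /allP/(_ j); rewrite mem_iota => /(_ j5)/or3P[/eqP e|/andP[/eqP ci /eqP j0]|].
- by move: ij e j5; lia.
(* From a pendant vertex to 0 the predecessor is the pendant vertex itself, which is not in the
   core. *)
- exists i; rewrite ij tdd tdE // ci j0 T50; split=> //.
  by rewrite /adjb !mem_cat !mem_pendants; have -> : 4 < i by [lia]; rewrite i_n !orbT.
case/hasP=> k; rewrite mem_iota => k5 /and3P[kj kjt /eqP e].
exists k; rewrite !tdE // e kj; split=> //; first by lia.
by move: kjt; rewrite /adjb !mem_cat => /orP[]->; rewrite ?orbT.
Qed.

Lemma sum_core m (F : nat -> nat) :
  \sum_(i < 5 + m) F i = \sum_(i < 5) F i + \sum_(k < m) F (5 + k).
Proof. exact: big_split_ord. Qed.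

Definition col_max T c := foldr maxn 0 [seq entry T k c | k <- iota 0 6].

(** The five core vertices come first, then the [m] pendant vertices, each of which sees [m.-1]
    others. *)
Definition core_eds T m :=
  sumn [seq col_max T i * (sumn [seq entry T j i | j <- iota 0 5] + m * entry T 5 i)
       | i <- iota 0 5] +
  m * (col_max T 5 * (sumn [seq entry T j 5 | j <- iota 0 5] + m.-1 * entry T 5 5)).

(** Attaining each column maximum off the diagonal makes it a distance between existing vertices,
    even when there is a single pendant vertex and [entry T 5 5] is not realised. *)
Lemma core_ecc_dist_sum t T m : core_ok t T ->
    all (fun c => has (fun k => (entry T k c == col_max T c) && (k != c)) (iota 0 6))
        (iota 0 6) ->
  ecc_dist_sum (core_graph (5 + m.+1) t) = core_eds T m.+1.
Proof.
move=> okT /allP attained.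
have [cG dE] := core_dist (leq_addr m.+1 5) okT.
have tdE i j : i != j -> table_dist T i j = entry T (minn i 5) (minn j 5).
  by rewrite /table_dist => /negbTE->.
have /and5P[_ _ _ /allP T0 _] := okT.
have td5 i j : j < 5 -> table_dist T i j = entry T (minn i 5) j.
  move=> j5; rewrite /table_dist (minn_idPl (ltnW j5)); case: eqVneq => // ->.
  by rewrite (minn_idPl (ltnW j5)) (eqP (T0 j _)) // mem_iota.
have td5' i j : i < 5 -> table_dist T i j = entry T i (minn j 5).
  move=> i5; rewrite /table_dist (minn_idPl (ltnW i5)); case: eqVneq => // <-.
  by rewrite (minn_idPl (ltnW i5)) (eqP (T0 i _)) // mem_iota.
have le_max k c : k <= 5 -> entry T k c <= col_max T c.
  move=> k5; rewrite /col_max foldrE big_map -/(index_iota 0 6) big_mkord.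
  exact: (leq_bigmax (F := fun k : 'I_6 => entry T k c) (Ordinal (k5 : k < 6))).
have eccE (i : core_graph (5 + m.+1) t) : eccentricity i = col_max T (minn i 5).
  apply/eqP; rewrite eqn_leq ecc_leq /=; last first.
    move=> j; rewrite dE /table_dist; case: ifP => // _; apply: le_max; exact: geq_minr.
  have /attained/hasP[k] : minn i 5 \in iota 0 6 by rewrite mem_iota; lia.
  rewrite mem_iota => k6 /andP[/eqP<- k5].
  have [j [jn ij <-]] : exists j, [/\ j < 5 + m.+1, j != i & minn j 5 = k].
    by exists k; move: k5; split; lia.
  have := leq_ecc (Ordinal jn : core_graph (5 + m.+1) t) i; rewrite dE /= tdE //.
(* The correction [4 < i] removes a pendant vertex from its own distance sum. *)
have distE (i : core_graph (5 + m.+1) t) : dist_sum i = sumn [seq entry T j (minn i 5) | j <- iota 0 5] +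
    (m.+1 - (4 < i)) * entry T 5 (minn i 5).
  rewrite /dist_sum; under eq_bigr do rewrite dE.
  rewrite (sum_core m.+1 (fun j => table_dist T j i)) sumn_iota; congr (_ + _).
    by apply: eq_bigr => j _; rewrite td5'.
  have [i5|i5] := ltnP i 5.
    rewrite subn0 (eq_bigr (fun=> entry T 5 i)) ?sum_nat_const ?card_ord // => j _.
    by rewrite td5 // (minn_idPl (ltnW i5)) (minn_idPr (leq_addr _ _)).
  have i5n : i - 5 < m.+1 by have := ltn_ord i; lia.
  rewrite subn1 (bigD1 (Ordinal i5n)) //= subnKC // /table_dist eqxx add0n.
  rewrite (eq_bigr (fun=> entry T 5 5)) => [|j ij]; last first.
    rewrite ifN ?(minn_idPr (leq_addr _ _)) ?(minn_idPr i5) //.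
    by apply: contra ij => /eqP e; apply/eqP/val_inj => /=; lia.
  by rewrite sum_nat_const cardC1 card_ord.
rewrite /ecc_dist_sum; under eq_bigr do rewrite eccE distE.
rewrite (sum_core m.+1 (fun i => col_max T (minn i 5) * (sumn [seq entry T j (minn i 5) | j <- iota 0 5] +
    (m.+1 - (4 < i)) * entry T 5 (minn i 5)))) /core_eds sumn_iota; congr (_ + _).
  by apply: eq_bigr => i _; rewrite leqNgt ltn_ord subn0 (minn_idPl (ltnW (ltn_ord i))).
rewrite (eq_bigr (fun=> col_max T 5 * (sumn [seq entry T j 5 | j <- iota 0 5] + m * entry T 5 5))).
  by rewrite sum_nat_const card_ord.
by move=> k _; rewrite (minn_idPr (leq_addr _ _)) ltn_addr // subn1.
Qed.

(** Pendant edges meet the core only at 0, so a core vertex here has only core edges and a pendant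
    vertex just one edge. *)
Lemma core_deg n t (i : core_graph n t) : 5 <= n ->
    all (fun e => (e.1 < 5) && (e.2 < 5)) t -> all (fun k => degb t k <= 3) (iota 0 5) ->
  (i : nat) != 0 -> deg i <= 3.
Proof.
move=> n5 /allP t5 /allP dt i0; apply: leq_trans (degb_ge i) _.
rewrite /degb count_cat count_map /=.
have -> : count (preim [eta pair 0] (fun p : nat * nat => (p.1 == i) || (p.2 == i))) (iota 5 (n - 5))
          = (4 < i).
  rewrite (eq_count (a2 := pred1 (i : nat))) => [|k]; last by rewrite /= eq_sym (negbTE i0).
  by rewrite count_uniq_mem ?iota_uniq // mem_iota subnKC // ltn_ord andbT.
have [i5|i5] := leqP i 4; first by rewrite addn0; apply: dt; rewrite mem_iota.
rewrite (eq_in_count (a2 := pred0)) ?count_pred0 // => e /t5/andP[e1 e2] /=.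
by lia.
Qed.

(** At most 3 core edges and n - 5 pendant edges meet at 0. *)
Lemma core_deg0 n t (i : core_graph n t) : 5 <= n -> degb t 0 <= 3 ->
  (i : nat) = 0 -> deg i + 2 <= n.
Proof.
move=> n5 dt i0; have {2}-> : n = 3 + (n - 5) + 2 by lia.
rewrite leq_add2r (leq_trans (degb_ge i)) // i0 /degb count_cat leq_add //.
by rewrite count_map -[X in _ <= X](size_iota 5) count_size.
Qed.

(** The restored leaf hangs on the vertex numbered 0 and receives the number [n], the one that
    [pendants n.+1] adds. *)
Lemma core_graph_extend n t (G : sgraph) (v s : G) (f : del_vertex v -> core_graph n t) s' :
    5 <= n -> all (fun e => (e.1 < 5) && (e.2 < 5)) t ->
    (forall x, adj v x = (x == s)) -> undel s' = s ->
    bijective f -> {mono f : x y / adj x y >-> adj x y} -> (f s' : nat) = 0 ->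
  isomorphic G (core_graph n.+1 t).
Proof.
move=> n5 /allP t5 vs es fB fM fs0; have [g fK gK] := fB.
have cG : #|G| = n.+1.
  by rewrite -(card_del_vertex v) (bij_eq_card fB) card_ord.
pose q := rcons [seq undel (g i) | i <- enum 'I_n] v.
have sq : size q = n.+1 by rewrite size_rcons size_map size_enum_ord.
have uq : uniq q.
  rewrite rcons_uniq map_inj_uniq ?enum_uniq ?andbT //; last first.
    exact: inj_comp (@undel_inj G v) (can_inj gK).
  by apply/mapP => -[i _ ev]; have := undel_neq (g i); rewrite -ev eqxx.
have qE i (lin : i < n) : nth v q i = undel (g (Ordinal lin)).
  rewrite nth_rcons size_map size_enum_ord lin (nth_map (Ordinal lin)) ?size_enum_ord //.
  by congr (undel (g _)); apply: val_inj; rewrite /= nth_enum_ord.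
have qn : nth v q n = v by rewrite nth_rcons size_map size_enum_ord ltnn eqxx.
have adj_last i : i < n -> adj (nth v q i) v = adjb (t ++ pendants n.+1) i n.
  move=> lin; rewrite adj_sym vs qE -es (inj_eq (@undel_inj G v)) -(inj_eq (can_inj fK)) gK.
  rewrite -(inj_eq val_inj) /= fs0 /adjb !mem_cat !mem_pendants.
  have -> : (i, n) \in t = false by apply/negP => /t5 /=; lia.
  have -> : (n, i) \in t = false by apply/negP => /t5 /=; lia.
  have n0 : (n == 0) = false by rewrite gtn_eqF // (leq_trans _ n5).
  by rewrite n0 ltnSn n5 !andbT orbF.
apply: (list_graph_iso (x0 := v) uq sq cG) => i j; rewrite !ltnS (leq_eqVlt i) (leq_eqVlt j).
move=> /orP[/eqP->|lin] /orP[/eqP->|ljn]; rewrite ?eqxx ?qn // => ij.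
- by rewrite adj_sym adj_last // adjb_sym.
- by rewrite adj_last.
rewrite !qE undel_adj -fM !gK /= /list_adj -(inj_eq val_inj) ij /= /adjb !mem_cat !mem_pendants.
by rewrite lin ljn !ltnS (ltnW lin) (ltnW ljn).
Qed.

(** * The extremal families *)

Definition core : seq (nat * nat) := triangle ++ [:: (0, 3); (3, 4)].
Definition core' : seq (nat * nat) := [:: (0, 1); (1, 2); (2, 3); (3, 4); (4, 0)].
Definition core_star : seq (nat * nat) := triangle ++ [:: (1, 3); (2, 4)].

Definition table := [:: [:: 0; 1; 1; 1; 2; 1]; [:: 1; 0; 1; 2; 3; 2]; [:: 1; 1; 0; 2; 3; 2];
  [:: 1; 2; 2; 0; 1; 2]; [:: 2; 3; 3; 1; 0; 3]; [:: 1; 2; 2; 2; 3; 2]].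
Definition table' := [:: [:: 0; 1; 2; 2; 1; 1]; [:: 1; 0; 1; 2; 2; 2]; [:: 2; 1; 0; 1; 2; 3];
  [:: 2; 2; 1; 0; 1; 3]; [:: 1; 2; 2; 1; 0; 2]; [:: 1; 2; 3; 3; 2; 2]].
Definition table_star := [:: [:: 0; 1; 1; 2; 2; 1]; [:: 1; 0; 1; 1; 2; 2]; [:: 1; 1; 0; 2; 1; 2];
  [:: 2; 1; 2; 0; 3; 3]; [:: 2; 2; 1; 3; 0; 3]; [:: 1; 2; 2; 3; 3; 2]].

Lemma core_okE : core_ok core table. Proof. by vm_compute. Qed.
Lemma core_ok'E : core_ok core' table'. Proof. by vm_compute. Qed.
Lemma core_ok_starE : core_ok core_star table_star. Proof. by vm_compute. Qed.

(** Here and in the next two lemmas the additive form avoids truncated subtraction. *)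
Lemma U3_eds n : 6 <= n -> ecc_dist_sum (U3 n) + 9 * n + 14 = 6 * n ^ 2.
Proof.
move=> n6; have [m ->] : exists m, n = 5 + m.+1 by exists (n - 6); lia.
rewrite [ecc_dist_sum _](core_ecc_dist_sum m core_okE) //.
rewrite /core_eds /col_max /entry /maxn /= -!mulnn; lia.
Qed.

Lemma U3'_eds n : 6 <= n -> ecc_dist_sum (U3' n) + 5 * n + 53 = 6 * n ^ 2.
Proof.
move=> n6; have [m ->] : exists m, n = 5 + m.+1 by exists (n - 6); lia.
rewrite [ecc_dist_sum _](core_ecc_dist_sum m core_ok'E) //.
rewrite /core_eds /col_max /entry /maxn /= -!mulnn; lia.
Qed.

Lemma U3star_eds n : 6 <= n -> ecc_dist_sum (U3star n) + 5 * n + 45 = 6 * n ^ 2.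
Proof.
move=> n6; have [m ->] : exists m, n = 5 + m.+1 by exists (n - 6); lia.
rewrite [ecc_dist_sum _](core_ecc_dist_sum m core_ok_starE) //.
rewrite /core_eds /col_max /entry /maxn /= -!mulnn; lia.
Qed.

Definition edge_ends n s :=
  sumn [seq sumn [seq nat_of_bool ((i != j) && adjb s i j) | j <- iota 0 n] | i <- iota 0 n].

Lemma card_edges_list_graph n s : 2 * #|edges (list_graph n s)| = edge_ends n s.
Proof.
rewrite -sum_deg /edge_ends sumn_iota; apply: eq_bigr => i _.
rewrite sumn_iota /deg -sum1_card big_mkcond /=; apply: eq_bigr => j _.
by rewrite inE /= /list_adj -(inj_eq val_inj) -/(adjb _ _ _); case: (_ && _).
Qed.

Lemma core_graph_class n t T : 5 <= n -> core_ok t T -> valid n (t ++ pendants n) ->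
    edge_ends n (t ++ pendants n) = 2 * n -> max_matching [::] (t ++ pendants n) = 3 ->
  unicyclic_class n 3 (core_graph n t).
Proof.
move=> n5 okT vs es ms; have [cG _] := core_dist n5 okT; split; last 1 first.
- by rewrite matching_number_list_graph.
- apply/andP; split=> //; rewrite -(eqn_pmul2l (m := 2)) // card_edges_list_graph es.
  by rewrite card_ord.
exact: card_ord.
Qed.

Definition cores := [:: core; core'; core_star].

(** The base cases n = 6, 7, 8, 9. *)
Lemma cores_check : all (fun n => check_all n [seq t ++ pendants n | t <- cores]) (iota 6 4).
Proof. by vm_compute. Qed.

(** A common lower bound for the three families. The constant 17 is dictated by [U3'] at n = 9,
    where 5n + 53 = 9n + 17. *)
Lemma cores_eds n t : 9 <= n -> t \in cores -> 6 * n ^ 2 <= ecc_dist_sum (core_graph n t) + 9 * n + 17.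
Proof.
move=> n9; have n6 : 6 <= n by lia.
rewrite !inE => /or3P[]/eqP->.
- have := U3_eds n6; rewrite -[U3 n]/(core_graph n core); lia.
- have := U3'_eds n6; rewrite -[U3' n]/(core_graph n core'); lia.
- have := U3star_eds n6; rewrite -[U3star n]/(core_graph n core_star); lia.
Qed.

Lemma cores_small t : t \in cores ->
  all (fun e => (e.1 < 5) && (e.2 < 5)) t && all (fun k => degb t k <= 3) (iota 0 5).
Proof. by rewrite !inE => /or3P[]/eqP->; vm_compute. Qed.

(** * Induction on the number of vertices *)

Definition extremal_or_far n G :=
  far_from_extremal n G \/ exists2 t, t \in cores & isomorphic G (core_graph n t).

Lemma extremal_or_far_step n (G : sgraph) : 9 <= n ->
    (forall H, unicyclic_class n 3 H -> extremal_or_far n H) ->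
  unicyclic_class n.+1 3 G -> extremal_or_far n.+1 G.
Proof.
move=> n9 IH [uG cG mG].
have [||v [s [vs mH]]] := exists_unmatched_leaf uG; rewrite ?mG ?cG //.
have /andP[conG _] := uG; set H := del_vertex v.
have uH : unicyclic H by apply: del_leaf_unicyclic vs uG.
have /andP[conH _] := uH.
have cH : #|H| = n by have := card_del_vertex v; rewrite cG => -[].
have [s' es] : exists s' : H, undel s' = s.
  by apply: undelP; rewrite eq_sym adj_neq // vs.
have xiG := ecc_dist_sum_del_leaf vs conG.
have far_deg : (forall x : H, deg x + (x == s') + 3 <= n.+1) -> forall x : G, deg x + 3 <= n.+1.
  move=> dH x; have [->|xv] := eqVneq x v; first by rewrite (deg_leaf vs); lia.
  have [x' <-] : exists x' : H, undel x' = x by apply: undelP.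
  by rewrite (deg_undel vs) -es (inj_eq (@undel_inj G v)).
have inc : (forall x : H, deg x + (x == s') + 3 <= n.+1) ->
    ecc_dist_sum H + 18 * n.+1 <= ecc_dist_sum G + 6 * (deg s').+1 + 29.
  move=> dH; have ds : deg s = (deg s').+1 by rewrite -es (deg_undel vs) es eqxx addn1.
  have := @leaf_increment G v s vs uG; rewrite ds cG => /(_ _)h.
  have := dH s'; rewrite eqxx => dHs; move: h xiG => /(_ ltac:(lia)).
  move: (\sum_(u | _) _); rewrite -/H; lia.
have [|[xiH dH]|[t tc [f fB fM]]] := IH H; first by split; rewrite // mH.
  have dH' (x : H) : deg x + (x == s') + 3 <= n.+1 by have := dH x; case: (x == s'); lia.
  left; split; last exact: far_deg.
  (* As [deg s'] is at most n - 3, the increment is at least 12n + 1, exactly the growth of 6n^2 -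
     5n - 44 from n to n + 1. *)
  have := inc dH'; have := dH s'; nia.
have /andP[t5 td] := cores_small tc.
have n5 : 5 <= n by lia.
have [fs0|fs0] := eqVneq (f s' : nat) 0.
  by right; exists t => //; apply: core_graph_extend vs es fB fM fs0.
have dH (x : H) : (f x : nat) != 0 -> deg x <= 3.
  by move=> fx; rewrite -(deg_iso x fB fM) core_deg.
have dH' (x : H) : deg x + (x == s') + 3 <= n.+1.
  have [fx|fx] := eqVneq (f x : nat) 0; last by have := dH x fx; case: (x == s'); lia.
  have -> : (x == s') = false by apply: contra_neqF fs0 => /eqP<-.
  have := @core_deg0 n t (f x) n5; rewrite (deg_iso x fB fM) => /(_ _ fx) h.
  by have := h (allP td 0 isT); lia.
(* Here [deg s'] is at most 3, so the increment is at least 18n - 35. Added to 6n^2 - 9n - 17 it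
   exceeds the required 6n^2 + 7n - 43. *)
left; split; last exact: far_deg.
have := inc dH'; have := dH s' fs0; have := cores_eds n9 tc.
have -> : ecc_dist_sum (core_graph n t) = ecc_dist_sum H.
  by apply/esym/ecc_dist_sum_iso => //; exists f.
nia.
Qed.

Lemma extremal_or_farP n (G : sgraph) : 6 <= n -> unicyclic_class n 3 G -> extremal_or_far n G.
Proof.
elim: n G => // n IHn G n6; have [n9|n9] := leqP 9 n.
  by apply: extremal_or_far_step => // H; apply: IHn; lia.
have /(allP cores_check) chk : n.+1 \in iota 6 4 by rewrite mem_iota; lia.
by case/(check_all_sound chk) => [|[_ /mapP[t tc ->]]]; [left|right; exists t].
Qed.

(** Everything outside the classes of [A] and [B] lies strictly above [B]. A second minimal graph is
    above [A] and not above [B], so only the class of [B] is left. *)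
Lemma unique_second_minimal_of (P : sgraph -> Prop) (f : sgraph -> nat) (A B : sgraph) :
    P A -> P B -> f A < f B ->
    (forall H K, P H -> isomorphic H K -> f H = f K) ->
    (forall H, P H -> [\/ isomorphic H A, isomorphic H B | f B < f H]) ->
  unique_second_minimal P f B.
Proof.
move=> PA PB AB fiso dich.
have fA H : P H -> f A <= f H.
  by move=> PH; case: (dich H PH) => [/fiso->|/fiso->|] //; lia.
split.
  split=> //; exists A; split=> // H PH AH.
  by case: (dich H PH) => [/fiso e|/fiso->|/ltnW] //; rewrite e // ltnn in AH.
move=> H [PH [A' [PA' A'min A'H Hmin]]].
have eA : f A' = f A by apply/eqP; rewrite eqn_leq A'min //= fA.
case: (dich H PH) => // [/fiso e|BH].
  by rewrite eA e // ltnn in A'H.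
by have := Hmin B PB; rewrite eA => /(_ AB); rewrite leqNgt BH.
Qed.

Lemma U3_class n : n = 8 \/ n = 9 -> unicyclic_class n 3 (U3 n).
Proof. by case=> ->; apply: (core_graph_class (t := core) _ core_okE); vm_compute. Qed.

Lemma U3'_class n : 6 <= n <= 9 -> unicyclic_class n 3 (U3' n).
Proof.
case/andP; do 10?[case: n => [|n] //] => _ _;
  by apply: (core_graph_class (t := core') _ core_ok'E); vm_compute.
Qed.

Lemma U3star_class n : n = 6 \/ n = 7 -> unicyclic_class n 3 (U3star n).
Proof. by case=> ->; apply: (core_graph_class (t := core_star) _ core_ok_starE); vm_compute. Qed.

Lemma ecc_dist_sum_class n m (H K : sgraph) :
  unicyclic_class n m H -> isomorphic H K -> ecc_dist_sum H = ecc_dist_sum K.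
Proof. by case=> /andP[cH _] _ _; apply: ecc_dist_sum_iso. Qed.

Lemma classification n (G : sgraph) : 6 <= n -> unicyclic_class n 3 G ->
  [\/ isomorphic G (U3 n), isomorphic G (U3' n), isomorphic G (U3star n)
    | 6 * n ^ 2 <= ecc_dist_sum G + 5 * n + 44].
Proof.
move=> n6 /(extremal_or_farP n6)[[xi _]|[t]]; first exact: Or44.
by rewrite !inE => /or3P[]/eqP-> GK; [apply: Or41|apply: Or42|apply: Or43].
Qed.

Theorem theorem3p5 (n : nat) (hn : 6 <= n) :
  [/\ (n = 6 \/ n = 7 ->
        unique_second_minimal (unicyclic_class n 3) ecc_dist_sum (U3star n)),
      (n = 8 \/ n = 9 ->
        unique_second_minimal (unicyclic_class n 3) ecc_dist_sum (U3 n))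
    & (10 <= n -> forall G : sgraph,
        unicyclic_class n 3 G -> ~ isomorphic G (U3 n) ->
        6 * n ^ 2 - 5 * n - 53 <= ecc_dist_sum G /\
        (ecc_dist_sum G = 6 * n ^ 2 - 5 * n - 53 <-> isomorphic G (U3' n)))].
Proof.
have e := U3_eds hn; have e' := U3'_eds hn; have es := U3star_eds hn.
split=> [n67|n89|n10 G GP nU3].
(* For n = 6, 7 one has 9n + 14 < 5n + 45 < 5n + 53, so the values increase from [U3'] to [U3star]
   to [U3]. *)
- apply: (@unique_second_minimal_of _ _ (U3' n)); [| exact: U3star_class | lia | exact: ecc_dist_sum_class |].
    by apply: U3'_class; lia.
  move=> H PH; case: (classification hn PH) => [/(ecc_dist_sum_class PH) eH|||xi].
  + by apply: Or33; lia.
  + exact: Or31.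
  + exact: Or32.
  + by apply: Or33; lia.
(* For n = 8, 9 one has 5n + 45 < 9n + 14 < 5n + 53, so [U3] now comes between [U3'] and
   [U3star]. *)
- apply: (@unique_second_minimal_of _ _ (U3' n)); [| exact: U3_class | lia | exact: ecc_dist_sum_class |].
    by apply: U3'_class; lia.
  move=> H PH; case: (classification hn PH) => [||/(ecc_dist_sum_class PH) eH|xi].
  + exact: Or32.
  + exact: Or31.
  + by apply: Or33; lia.
  + by apply: Or33; lia.
have vU' : isomorphic G (U3' n) -> ecc_dist_sum G = 6 * n ^ 2 - 5 * n - 53.
  by move/(ecc_dist_sum_class GP) ->; lia.
(* With [U3] excluded, every graph other than [U3'] has value at least 6n^2 - 5n - 45, strictly
   above the bound. *)
case: (classification hn GP) => [//|GU|/(ecc_dist_sum_class GP) eG|xi].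
- by rewrite vU'.
- by split; [lia|split=> [|/vU'//]; lia].
by split; [lia|split=> [|/vU'//]; lia].
Qed.
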